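(* Let $a<b$ be real numbers and let $f:[a,b]\to\mathbb{R}$ be a differentiable function whose derivative $f':[a,b]\to\mathbb{R}$ is an absolutely continuous function such that $f''\in L_2(a,b)$. Then $$|Q(f;a,b)-P(f;a,b)|\le\sqrt{\frac{47}{23040}-\frac{\sqrt2}{768}}\;\sigma(f'';a,b)\,(b-a)^{5/2}.$$ This inequality is sharp in the sense that the constant $\sqrt{\frac{47}{23040}-\frac{\sqrt2}{768}}$ cannot be replaced by a smaller one (i.e. by a smaller constant for which the inequality would still hold for all such $f$).
   Context: For $f$ on $[a,b]$, $$Q(f;a,b)=\int_a^b f(t)\,dt-\left[\frac{\sqrt2}{8}f(a)+\left(1-\frac{\sqrt2}{4}\right)f\left(\frac{a+b}{2}\right)+\frac{\sqrt2}{8}f(b)\right](b-a),$$ $$P(f;a,b)=\frac{(b-a)^2}{96}\left(4-3\sqrt2\right)\left[f'(b)-f'(a)\right].$$ For real-valued $g\in L_2(a,b)$, $\sigma(g;a,b)=\sqrt{(b-a)\,T(g,g)}$, where $T(g,g)=\frac1{b-a}\int_a^b g(t)^2\,dt-\left(\frac1{b-a}\int_a^b g(t)\,dt\right)^2$. *)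

(* Defs.v *)
From mathcomp Require Export all_boot all_order all_algebra.
From mathcomp Require Export all_classical all_reals all_analysis.
Export Order.TTheory GRing.Theory Num.Theory.
Export numFieldNormedType.Exports.

Set Implicit Arguments.
Unset Strict Implicit.
Unset Printing Implicit Defensive.

Local Open Scope classical_set_scope.
Local Open Scope ring_scope.

(* A function on [a, b] is a function R -> R of which only the values on      *)
(* [a, b] are ever used. Derivatives at a point x of [a, b] are limits of the *)
(* difference quotient f y - f x over y - x with y in [a, b], y != x; hence   *)
(* they are two-sided in the interior of [a, b] and one-sided at a and b.     *)

Definition slope_within {R : realType} (a b : R) (f : R -> R) (x : R) :
    set_system R :=
  (fun y => (f y - f x) / (y - x)) @ within `[a, b] x^'.

Definition differentiable_within {R : realType} (a b : R) (f : R -> R) : Prop :=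
  forall x : R, x \in `[a, b] -> cvg (slope_within a b f x).

(* Unspecified at the points where the limit does not exist; this matters     *)
(* only for second derivatives, which are used up to null sets.               *)
Definition derivative_within {R : realType} (a b : R) (f : R -> R) : R -> R :=
  fun x => lim (slope_within a b f x).

Definition absolutely_continuous {R : realType} (a b : R) (g : R -> R) : Prop :=
  forall e : R, 0 < e -> exists2 d : R, 0 < d &
    forall (n : nat) (s t : 'I_n -> R),
      (forall i, a <= s i /\ s i <= t i /\ t i <= b) ->
      trivIset setT (fun i => `]s i, t i[%classic) ->
      \sum_(i < n) (t i - s i) < d ->
      \sum_(i < n) `|g (t i) - g (s i)| < e.

(* The extension of g by 0 outside [a, b] is measurable and in L^2(R).        *)
Definition square_integrable {R : realType} (a b : R) (g : R -> R) : Prop :=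
  g \_ `[a, b] \in Lfun (@lebesgue_measure R) 2%:E.

Definition quad_error {R : realType} (f : R -> R) (a b : R) : R :=
  (\int[lebesgue_measure]_(t in `[a, b]) f t)
  - (Num.sqrt 2 / 8 * f a + (1 - Num.sqrt 2 / 4) * f ((a + b) / 2)
     + Num.sqrt 2 / 8 * f b) * (b - a).

Definition quad_correction {R : realType} (f : R -> R) (a b : R) : R :=
  (b - a) ^+ 2 / 96 * (4 - 3 * Num.sqrt 2)
  * (derivative_within a b f b - derivative_within a b f a).

Definition chebyshevT {R : realType} (g : R -> R) (a b : R) : R :=
  (b - a)^-1 * (\int[lebesgue_measure]_(t in `[a, b]) (g t ^+ 2))
  - ((b - a)^-1 * (\int[lebesgue_measure]_(t in `[a, b]) g t)) ^+ 2.

Definition sigma {R : realType} (g : R -> R) (a b : R) : R :=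
  Num.sqrt ((b - a) * chebyshevT g a b).

Definition admissible {R : realType} (a b : R) (f : R -> R) : Prop :=
  let f' := derivative_within a b f in
  let f'' := derivative_within a b f' in
  [/\ differentiable_within a b f,
      absolutely_continuous a b f' &
      square_integrable a b f''].

Definition quad_bound {R : realType} (C a b : R) (f : R -> R) : Prop :=
  let f'' := derivative_within a b (derivative_within a b f) in
  `|quad_error f a b - quad_correction f a b|
    <= C * sigma f'' a b * (b - a) `^ (5 / 2).

Definition sharp_constant {R : realType} : R :=
  Num.sqrt (47 / 23040 - Num.sqrt 2 / 768).

(* Main.v *)
Require Import Defs.
From HB Require Import structures.
From mathcomp Require Import measurable_realfun ring lra.

(** Two integrations by parts write the quadrature error as the integral of the
    second derivative of [f] against the Peano kernel of the formula, which is
    continuous and quadratic on each half of [[a, b]] ([peano_identity]). The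
    correction term is the mean of that kernel times the integral of the second
    derivative. Hence [quad_error - quad_correction] is the integral of the second
    derivative against the kernel minus its mean ([deviation_identity]). Against a
    kernel of mean zero, the second derivative may itself be replaced by its
    deviation from its mean, whose L^2 norm is [sigma]; the Cauchy-Schwarz
    inequality ([variance_cauchy_schwarz]) then bounds the integral by [sigma]
    times the L^2 norm of the centred kernel, which is
    [sharp_constant * (b - a) `^ (5 / 2)] ([Rintegral_mean_zero_kernel_sqr]).
    Equality holds when the second derivative is the Peano kernel, that is for an
    explicit piecewise polynomial of degree 4 ([extremal]), so that no smaller
    constant is possible ([sharpness]).

    The derivative of [f] is only absolutely continuous, so the integrations by
    parts rest on the fundamental theorem of calculus for such functions
    ([ac_derivative]): they are differentiable almost everywhere and are the
    integrals of their derivatives. An absolutely continuous function has bounded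
    variation and is the difference of two nondecreasing absolutely continuous
    functions ([small_increments_split]). The Stieltjes measure of such a function
    vanishes on Lebesgue-null sets ([small_increments_null]), hence has a density
    by the Radon-Nikodym theorem ([nondecreasing_density]), and Lebesgue's
    differentiation theorem identifies this density with the derivative. *)

Set Implicit Arguments.
Unset Strict Implicit.
Unset Printing Implicit Defensive.

Local Open Scope classical_set_scope.
Local Open Scope ring_scope.

(** * Families of nonoverlapping intervals *)

Section interval_families.
Context {R : realType}.
Implicit Types (a b : R) (g : R -> R) (l : seq (R * R)).

(** Endpoints are compared directly, rather than open intervals being disjoint:
    a degenerate interval inside another one is then excluded, and the relation
    is inherited by subintervals and by monotone images. *)
Definition nonoverlapping (p q : R * R) := (p.2 <= q.1) || (q.2 <= p.1).

Definition interval_family a b l :=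
  all (fun p => [&& a <= p.1, p.1 <= p.2 & p.2 <= b]) l
  && pairwise nonoverlapping l.

Definition total_length l : R := \sum_(p <- l) (p.2 - p.1).

Definition increments g l : R := \sum_(p <- l) `|g p.2 - g p.1|.

Definition consecutive_pairs (x : R) (s : seq R) := pairmap pair x s.

Lemma nonoverlapping_disjoint p q :
  nonoverlapping p q -> `]p.1, p.2[%classic `&` `]q.1, q.2[%classic = set0.
Proof.
move=> /orP[] pq; apply/seteqP; split => // x /=;
  rewrite !in_itv/= => -[/andP[? ?] /andP[? ?]]; lra.
Qed.

Lemma absolutely_continuous_family a b g : absolutely_continuous a b g ->
  forall e : R, 0 < e -> exists2 d : R, 0 < d &
    forall l, interval_family a b l -> total_length l < d -> increments g l < e.
Proof.
move=> gac e /gac[d d0 gd]; exists d => // l /andP[lab lno] ld.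
rewrite /increments (big_nth (0, 0)) big_mkord.
apply: (gd _ (fun i : 'I_(size l) => (nth (0, 0) l i).1)
             (fun i : 'I_(size l) => (nth (0, 0) l i).2)).
- by move=> i; have /and3P[] := all_nthP (0, 0) lab i (ltn_ord i).
- apply/trivIsetP => i j _ _ ij; apply: nonoverlapping_disjoint.
  have := pairwiseP (0, 0) lno.
  have [ltij|ltji|/val_inj/eqP] := ltngtP i j; last by rewrite (negbTE ij).
  + by apply => //; rewrite inE.
  + by rewrite /nonoverlapping orbC; apply => //; rewrite inE.
- by move: ld; rewrite /total_length (big_nth (0, 0)) big_mkord.
Qed.

Lemma consecutive_pairs_bounds (x y : R) (s : seq R) : path <%R x s ->
    last x s <= y ->
  all (fun p => [&& x <= p.1, p.1 <= p.2 & p.2 <= y]) (consecutive_pairs x s).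
Proof.
elim: s x => //= z s IH x /andP[xz zs] sy.
have zy : z <= y.
  apply: le_trans sy; elim: s z zs {IH xz} => //= u s IH z /andP[zu us].
  exact/(le_trans (ltW zu))/IH.
rewrite lexx (ltW xz) zy/=; apply: sub_all (IH z zs sy) => p /and3P[zp -> ->].
by rewrite (le_trans (ltW xz) zp).
Qed.

Lemma consecutive_pairs_nonoverlapping (x : R) (s : seq R) : path <%R x s ->
  pairwise nonoverlapping (consecutive_pairs x s).
Proof.
elim: s x => //= z s IH x /andP[xz zs]; rewrite IH// andbT.
apply: sub_all (consecutive_pairs_bounds zs (lexx _)) => p /and3P[zp _ _].
by rewrite /nonoverlapping/= zp.
Qed.

Lemma total_length_consecutive_pairs (x : R) (s : seq R) :
  total_length (consecutive_pairs x s) = last x s - x.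
Proof.
rewrite /total_length; elim: s x => [|z s IH] x /=; first by rewrite big_nil subrr.
by rewrite big_cons IH/=; ring.
Qed.

Lemma variation_increments (x y : R) g (s : seq R) :
  variation x y g s = increments g (consecutive_pairs x s).
Proof.
rewrite /variation /increments/=; elim: s x => [|z s IH] x /=.
  by rewrite big_nil big_geq.
by rewrite big_cons big_nat_recl//= -IH.
Qed.

Lemma consecutive_pairs_nonoverlapping_rest (p : R * R) l (s : seq R) :
  path <%R p.1 s -> last p.1 s = p.2 ->
  all (nonoverlapping p) l ->
  allrel nonoverlapping (consecutive_pairs p.1 s) l.
Proof.
move=> ps pl /allP pnl; apply/allrelP => q r qs rl.
have /allP/(_ _ qs)/and3P[pq _ qp] := consecutive_pairs_bounds ps (lexx _).
move: (pnl _ rl); rewrite /nonoverlapping pl in qp *.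
by case/orP => ?; apply/orP; [left|right]; lra.
Qed.

End interval_families.

(** * Total variations over families of intervals *)

Section total_variation.
Context {R : realType}.
Implicit Types (a b : R) (g : R -> R) (l : seq (R * R)).

Lemma nonoverlappingC (p q : R * R) : nonoverlapping p q = nonoverlapping q p.
Proof. by rewrite /nonoverlapping orbC. Qed.

Lemma refine_family a b (p : R * R) l (s : seq R) : itv_partition p.1 p.2 s ->
  interval_family a b (p :: l) ->
  interval_family a b (consecutive_pairs p.1 s ++ l).
Proof.
move=> [ps /eqP pl] /andP[/= /andP[/and3P[ap pp pb] lab] /andP[pnl lno]].
apply/andP; split; rewrite ?all_cat ?pairwise_cat ?lab ?andbT.
  apply: sub_all (consecutive_pairs_bounds ps (lexx _)) => q.
  rewrite pl => /and3P[pq -> qp].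
  by rewrite (le_trans ap pq) (le_trans qp pb).
rewrite lno consecutive_pairs_nonoverlapping//.
by rewrite consecutive_pairs_nonoverlapping_rest.
Qed.

Lemma interval_family_catCA a b l1 l2 l3 :
  interval_family a b (l1 ++ l2 ++ l3) = interval_family a b (l2 ++ l1 ++ l3).
Proof.
rewrite /interval_family !all_cat !pairwise_cat !allrel_catr.
have -> : allrel nonoverlapping l1 l2 = allrel nonoverlapping l2 l1.
  by rewrite allrelC; apply: eq_allrel => p q; exact: nonoverlappingC.
by case: (all _ l1); case: (all _ l2); case: (allrel _ l1 l3);
  case: (allrel _ l2 l1); case: (allrel _ l2 l3); case: (pairwise _ l1);
  rewrite ?andbF.
Qed.

(** A total variation is a supremum over subdivisions, so replacing an interval
    by a subdivision of it, which changes neither the disjointness nor the total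
    length, turns the bound on increments into one on total variations. The
    intervals of [l1] are treated one at a time; [l2] collects the pieces of
    those already subdivided. *)
Lemma total_variation_family a b g (d e : R) :
  (forall l, interval_family a b l -> total_length l < d -> increments g l <= e) ->
  forall l1 l2, interval_family a b (l1 ++ l2) -> total_length (l1 ++ l2) < d ->
  (\sum_(p <- l1) total_variation p.1 p.2 g + (increments g l2)%:E <= e%:E)%E.
Proof.
move=> gd; elim=> [|p l1 IH] l2 lf ld.
  by rewrite big_nil add0e lee_fin; apply: gd.
have pp : p.1 <= p.2 by case/andP: lf => /= /andP[/and3P[]].
have TVge0 : (0 <= \sum_(p <- l1) total_variation p.1 p.2 g)%E.
  rewrite big_seq; apply: sume_ge0 => q ql1; apply: total_variation_ge0.
  case/andP: lf => /= /andP[_]; rewrite all_cat => /andP[/allP/(_ _ ql1)].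
  by case/and3P.
have rest_fin : (\sum_(q <- l1) total_variation q.1 q.2 g
    + (increments g l2)%:E)%E \is a fin_num.
  rewrite ge0_fin_numE; last by rewrite adde_ge0// lee_fin sumr_ge0.
  apply: (le_lt_trans (IH l2 _ _)); last exact: ltry.
    case/andP: lf => /= /andP[_ lab] /andP[_ lno].
    by rewrite /interval_family lab.
  by apply: le_lt_trans ld; rewrite /total_length big_cons lerDr subr_ge0.
rewrite big_cons -addeA -leeBrDr//.
apply: ge_ereal_sup => _ [_ [s ps <-] <-].
rewrite leeBrDr//.
rewrite variation_increments addeCA -EFinD.
have <- : increments g (consecutive_pairs p.1 s ++ l2) =
    increments g (consecutive_pairs p.1 s) + increments g l2.
  by rewrite /increments big_cat.
have permE : perm_eq (l1 ++ consecutive_pairs p.1 s ++ l2)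
    (consecutive_pairs p.1 s ++ l1 ++ l2).
  by rewrite perm_catCA.
apply: IH.
  by rewrite interval_family_catCA; exact: refine_family.
rewrite /total_length (perm_big _ permE)/= big_cat/=.
rewrite [X in X + _]total_length_consecutive_pairs.
by case: ps => _ /eqP ->; move: ld; rewrite /total_length big_cons.
Qed.

End total_variation.

(** * Decomposition of absolutely continuous functions into monotone ones *)

Section monotone_decomposition.
Context {R : realType}.
Implicit Types (a b : R) (g : R -> R) (l : seq (R * R)).

(** Absolute continuity in terms of sequences of intervals, whose order and
    number vary freely when intervals are subdivided; the non-strict final
    inequality makes the notion stable under suprema. *)
Definition small_increments a b g := forall e : R, 0 < e ->
  exists2 d : R, 0 < d & forall l, interval_family a b l ->
    total_length l < d -> increments g l <= e.

Lemma absolutely_continuous_small_increments a b g :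
  absolutely_continuous a b g -> small_increments a b g.
Proof.
move=> /absolutely_continuous_family gac e /gac[d d0 gd].
by exists d => // l lf ld; exact/ltW/gd.
Qed.

Lemma interval_family1 a b (s t : R) :
  a <= s -> s <= t -> t <= b -> interval_family a b [:: (s, t)].
Proof. by move=> *; apply/andP; split=> //=; rewrite andbT; apply/and3P; split. Qed.

(** On an interval shorter than the [d] associated with 1 the total variation is
    at most 1, and [n] such intervals cover a given segment. *)
Lemma small_increments_total_variation_fin a b g : small_increments a b g ->
  forall s t, a <= s -> s <= t -> t <= b -> total_variation s t g \is a fin_num.
Proof.
move=> /(_ 1 ltr01)[d d0 gd].
have TV1 s t : a <= s -> s <= t -> t <= b -> t - s < d ->
    (total_variation s t g <= 1)%E.
  move=> as_ st tb std.
  have := @total_variation_family _ a b g d 1 gd [:: (s, t)] [::].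
  rewrite /increments /total_length !big_seq1 big_nil adde0/=; apply => //.
  exact: interval_family1.
(* Steps of length d / 2 keep every piece strictly shorter than d. *)
have TVn n s t : a <= s -> s <= t -> t <= b -> t - s <= n%:R * (d / 2) ->
    (total_variation s t g <= n%:R%:E)%E.
  elim: n t => [|n IH] t as_ st tb.
    rewrite mul0r subr_le0 => ts.
    have -> : t = s by apply: le_anti; rewrite ts st.
    by rewrite total_variationxx.
  rewrite -natr1 mulrDl mul1r => tsn.
  have [ts|ts] := leP (t - d / 2) s.
    apply: (@le_trans _ _ 1%E); last by rewrite lee_fin lerDr ler0n.
    by apply: TV1 => //; lra.
  rewrite (total_variationD g (ltW ts)); last by lra.
  rewrite EFinD; apply: leeD.
    by apply: IH => //; lra.
  by apply: TV1 => //; lra.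
move=> s t as_ st tb; rewrite ge0_fin_numE ?total_variation_ge0//.
have /= tsB := @Num.Theory.archi_boundP R ((t - s) / (d / 2)) _.
apply: le_lt_trans (ltry (Num.bound ((t - s) / (d / 2)))%:R).
apply: TVn => //.
rewrite -ler_pdivrMr ?divr_gt0//; apply/ltW/tsB.
by rewrite divr_ge0 ?subr_ge0// ltW// divr_gt0.
Qed.

(** With [V x] the total variation on [[a, x]], [g] is the difference of the
    nondecreasing functions [V] and [V \- g], which are again absolutely
    continuous because [total_variation_family] bounds the increments of [V]. *)
Lemma small_increments_split a b g : a <= b -> small_increments a b g ->
  exists V : R -> R,
    [/\ {in `[a, b] &, nondecreasing_fun V},
        {in `[a, b] &, nondecreasing_fun (V \- g)},
        small_increments a b V & small_increments a b (V \- g)].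
Proof.
move=> ab gac; have TVfin := small_increments_total_variation_fin gac.
pose V x := fine (total_variation a x g).
have VB s t : a <= s -> s <= t -> t <= b ->
    (V t - V s)%:E = total_variation s t g.
  move=> as_ st tb; rewrite /V EFinB !fineK ?TVfin//; last 2 first.
  - exact: le_trans tb.
  - exact: le_trans st.
  rewrite (total_variationD g as_ st) addeAC subee ?add0e// TVfin//.
  exact: le_trans tb.
have gV s t : a <= s -> s <= t -> t <= b -> `|g t - g s| <= V t - V s.
  by move=> as_ st tb; rewrite -lee_fin VB// total_variation_ge.
have Vac : small_increments a b V.
  move=> e /gac[d d0 gd]; exists d => // l lf ld.
  have := total_variation_family gd (l1 := l) (l2 := [::]).
  rewrite cats0 => /(_ lf ld); rewrite /increments big_nil adde0.
  rewrite -lee_fin -sumEFin; apply: le_trans; rewrite !big_seq lee_sum// => p pl.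
  have /andP[/allP/(_ _ pl)/and3P[ap pp pb] _] := lf.
  rewrite ger0_norm; last exact: le_trans (gV _ _ ap pp pb).
  by rewrite VB.
exists V; split => //.
- move=> x y; rewrite !in_itv/= => /andP[ax _] /andP[_ yb] xy.
  by rewrite -subr_ge0 (le_trans _ (gV _ _ ax xy yb)).
- move=> x y; rewrite !in_itv/= => /andP[ax _] /andP[_ yb] xy.
  have := gV _ _ ax xy yb; have := ler_norm (g y - g x).
  by lra.
- move=> e e0; have e20 : 0 < e / 2 by rewrite divr_gt0.
  have [d d0 gd] := gac _ e20; have [d' d'0 Vd] := Vac _ e20.
  exists (Num.min d d'); first by rewrite lt_min d0.
  move=> l lf; rewrite lt_min => /andP[ld ld'].
  have := lerD (gd _ lf ld) (Vd _ lf ld'); rewrite -splitr; apply: le_trans.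
  rewrite /increments -big_split/=; apply: ler_sum => p _.
  have := ler_normB (V p.2 - V p.1) (g p.2 - g p.1).
  by rewrite [leRHS]addrC; congr (`|_| <= _); ring.
Qed.

End monotone_decomposition.

(** * Extension by constants, and open intervals *)

Section clamped_functions.
Context {R : realType}.
Implicit Types (a b : R) (g H : R -> R) (l : seq (R * R)).

(** Composition with [clamp a b] extends a function from [[a, b]] to the whole
    line by its values at the endpoints. *)
Definition clamp a b x : R := Num.max a (Num.min x b).

Lemma clamp_itv a b x : a <= b -> a <= clamp a b x <= b.
Proof.
by move=> ab; rewrite /clamp le_max lexx/= ge_max ab ge_min lexx orbT.
Qed.

Lemma clamp_homo a b : {homo clamp a b : x y / x <= y}.
Proof.
move=> x y xy; rewrite /clamp ge_max !le_max lexx/= le_min !ge_min xy lexx.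
by rewrite !orbT.
Qed.

Lemma clamp_id a b x : a <= x -> x <= b -> clamp a b x = x.
Proof. by move=> ax xb; rewrite /clamp min_l// max_r. Qed.

Lemma clamp_lipschitz a b x y : x <= y ->
  clamp a b y - clamp a b x <= y - x.
Proof.
move=> xy; rewrite /clamp.
by case: (leP x b) => xb; case: (leP y b) => yb;
  case: (leP a x) => ax; case: (leP a y) => ay; case: (leP a b) => ab;
  rewrite ?(minElt, maxElt); lra.
Qed.

Lemma open_has_lt (U : set R) (x : R) : open U -> U x -> exists2 y, y < x & U y.
Proof.
rewrite openE => /[apply] /nbhs_ballP[e/= e0 xeU].
exists (x - e / 2); first by rewrite ltrBlDr ltrDl divr_gt0.
apply: xeU; rewrite /ball/= opprB addrC subrK gtr0_norm ?divr_gt0//.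
by rewrite ltr_pdivrMr// ltr_pMr// ltr1n.
Qed.

(** The half-open interval is the form in which Stieltjes measures are computed.
    An empty set gets the degenerate pair [(a, a)], which overlaps no other pair
    once all of them are clamped to [[a, b]]. *)
Lemma open_interval_bounds a (I : set R) : open I -> is_interval I ->
  (lebesgue_measure I < +oo)%E ->
  exists p : R * R, [/\ lebesgue_measure I = (p.2 - p.1)%:E,
    I `<=` `]p.1, p.2] &
    p = (a, a) \/ (p.1 < p.2 /\ `]p.1, p.2[ `<=` I)].
Proof.
move=> oI /is_intervalP II.
have [->|I0] := eqVneq I set0.
  by exists (a, a); rewrite measure0 subrr; split => //; left.
case: (Rhull I) II => -[x s|[|]] [y t|[|]] II;
  rewrite II lebesgue_measure_itv/= ?ltxx//.
- have st : s < t.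
    have /set0P[u Iu] := I0; have [v vu Iv] := open_has_lt oI Iu.
    move: Iu Iv; rewrite II/= !in_itv/= => /andP[_ ut] /andP[sv _].
    by rewrite (le_lt_trans (lteifW sv))// (lt_le_trans vu)// (lteifW ut).
  rewrite lte_fin st => _; exists (s, t); split => //=.
    move=> u; rewrite -II => Iu; have [v vu Iv] := open_has_lt oI Iu.
    move: Iu Iv; rewrite II/= !in_itv/= => /andP[_ ut] /andP[sv _].
    by rewrite (le_lt_trans (lteifW sv) vu) (lteifW ut).
  right; split => // u; rewrite /= !in_itv/= => /andP[su ut].
  by rewrite !lteifS.
- by have /set0P[u] := I0; rewrite II/= in_itv/= andbF.
- by rewrite ltry/= ltxx.
- by rewrite ltNyr/= ltxx.
all: by have /set0P[u] := I0; rewrite II/= in_itv/= ?andbF.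
Qed.

End clamped_functions.

(** * Lebesgue-null sets are null for Stieltjes measures *)

Section null_sets.
Context {R : realType}.
Implicit Types (a b : R) (g H : R -> R) (l : seq (R * R)).

Lemma clamp_nonoverlapping a b (p q : R * R) : nonoverlapping p q ->
  nonoverlapping (clamp a b p.1, clamp a b p.2) (clamp a b q.1, clamp a b q.2).
Proof. by case/orP => pq; apply/orP; [left|right]; exact: clamp_homo. Qed.

Lemma disjoint_nonoverlapping (p q : R * R) : p.1 < p.2 -> q.1 < q.2 ->
  `]p.1, p.2[%classic `&` `]q.1, q.2[%classic = set0 -> nonoverlapping p q.
Proof.
move=> pp qq pq0; rewrite /nonoverlapping; have [//|qp] := leP p.2 q.1.
have [//|pq] := leP q.2 p.1; exfalso.
suff : set0 ((Num.max p.1 q.1 + Num.min p.2 q.2) / 2) by [].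
rewrite -pq0; split; rewrite /= in_itv/=;
  case: (leP p.1 q.1); case: (leP p.2 q.2) => *; apply/andP; split; lra.
Qed.

Lemma small_increments_continuous a b H : a <= b -> small_increments a b H ->
  continuous (H \o clamp a b).
Proof.
move=> ab Hac x; apply/cvgrPdist_le => e e0.
have [d d0 Hd] := Hac _ e0.
have key u v : u <= v -> v - u < d ->
    `|H (clamp a b v) - H (clamp a b u)| <= e.
  move=> uv vud.
  have := Hd [:: (clamp a b u, clamp a b v)].
  rewrite /increments /total_length !big_seq1/=; apply.
    apply: interval_family1; last by case/andP: (clamp_itv v ab).
      by case/andP: (clamp_itv u ab).
    exact: clamp_homo.
  exact: le_lt_trans (clamp_lipschitz _ _ uv) vud.
near=> y; rewrite /=.
have : `|x - y| < d by near: y; exists d.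
have [xy|yx] := leP x y.
  by rewrite distrC ger0_norm ?subr_ge0// distrC; exact: key.
by rewrite ger0_norm ?subr_ge0 ?(ltW yx)//; exact: key (ltW yx).
Unshelve. all: by end_near. Qed.

Lemma lebesgue_stieltjes_itvoc (F : cumulative R R) (s t : R) : s <= t ->
  lebesgue_stieltjes_measure F `]s, t]%classic = (F t - F s)%:E.
Proof.
move=> st; rewrite /lebesgue_stieltjes_measure /measure_extension.
rewrite measurable_mu_extE/=; last exact: is_ocitv.
by rewrite wlength_itv_bnd.
Qed.

(** A Lebesgue-null set lies in an open set of small Lebesgue measure, which is a
    countable disjoint union of open intervals. Any finitely many of them have
    small total length, so the increments of [H] over them, that is their
    Stieltjes measure, sum up to at most [e]; hence so does the whole union. *)
Lemma small_increments_null a b H (F : cumulative R R) : a <= b ->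
  small_increments a b H -> F =1 H \o clamp a b ->
  forall A, measurable A -> lebesgue_measure A = 0%E ->
  lebesgue_stieltjes_measure F A = 0%E.
Proof.
move=> ab Hac FE A mA A0.
have [nu nuE] : exists nu : {measure set (measurableTypeR R) -> \bar R},
    nu = lebesgue_stieltjes_measure F :> (set _ -> _).
  by exists (lebesgue_stieltjes_measure F).
rewrite -nuE.
apply/eqP; rewrite eq_le measure_ge0 andbT; apply/lee_addgt0Pr => e e0.
rewrite add0e.
have [d d0 Hd] := Hac _ e0.
have [|U [oU AU Ud]] := @lebesgue_regularity_outer _ A d mA _ d0.
  by rewrite [ltLHS]A0.
have mU : measurable U by exact: open_measurable.
have {}Ud : (lebesgue_measure U < d%:E)%E.
  have -> := measureDI (@lebesgue_measure R) mU mA.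
  by rewrite (setIidr AU) [X in (_ + X)%E]A0 adde0.
pose I := open_disjoint_itv oU.
have mI k : measurable (I k).
  by apply: open_measurable; exact: open_disjoint_itv_open.
have UE := open_disjoint_itv_bigcup oU.
apply: (@le_trans _ _ (nu U)); first by rewrite le_measure ?inE.
have mUI : measurable (\bigcup_k I k) by rewrite -UE.
have lamU : lebesgue_measure U = (\sum_(0 <= k <oo) lebesgue_measure (I k))%E.
  have <- := measure_semi_bigcup lebesgue_measure mI
    (@open_disjoint_itv_trivIset R U oU) mUI.
  by congr lebesgue_measure.
have -> : nu U = (\sum_(0 <= k <oo) nu (I k))%E.
  have <- := measure_semi_bigcup nu mI (@open_disjoint_itv_trivIset R U oU) mUI.
  exact: (congr1 nu UE).
have /choice[p pI] : forall k, exists p : R * R,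
    [/\ lebesgue_measure (I k) = (p.2 - p.1)%:E, I k `<=` `]p.1, p.2] &
        p = (a, a) \/ (p.1 < p.2 /\ `]p.1, p.2[ `<=` I k)].
  move=> k; apply: open_interval_bounds.
  - exact: open_disjoint_itv_open.
  - exact: open_disjoint_itv_is_interval.
  - apply: le_lt_trans (ltry d); apply: le_trans (ltW Ud).
    apply: le_measure; [by apply: mem_set; exact: mI|by apply: mem_set; exact: mU|].
    by move=> x Ix; rewrite UE; exists k.
have pp k : (p k).1 <= (p k).2 by case: (pI k) => _ _ [->|[/ltW]].
apply: lime_le; first exact: is_cvg_nneseries.
apply: nearW => n.
pose q k := (clamp a b (p k).1, clamp a b (p k).2).
pose l := map q (iota 0 n).
apply: (@le_trans _ _ (increments H l)%:E).
  rewrite /increments big_map -sumEFin /index_iota subn0; apply: lee_sum => k _.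
  have [_ Ip _] := pI k.
  apply: (@le_trans _ _ (nu `](p k).1, (p k).2]%classic)).
    apply: le_measure; [by apply: mem_set; exact: mI| |exact: Ip].
    by apply: mem_set; exact: (@measurable_itv R `](p k).1, (p k).2]).
  by rewrite nuE lebesgue_stieltjes_itvoc// !FE lee_fin ler_norm.
rewrite lee_fin; apply: Hd.
  apply/andP; split.
    apply/allP => _ /mapP[k _ ->]/=; rewrite clamp_homo//.
    by case/andP: (clamp_itv (p k).1 ab) => ->; case/andP: (clamp_itv (p k).2 ab).
  rewrite pairwise_map; 
  have iota_lt : pairwise ltn (iota 0 n).
    by rewrite -(sorted_pairwise ltn_trans) iota_ltn_sorted.
  apply: sub_pairwise iota_lt => i j /= ij.
  have degenerate k r : nonoverlapping (clamp a b a, clamp a b a) (q r).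
    rewrite /nonoverlapping/= (clamp_id (lexx a) ab).
    by case/andP: (clamp_itv (p r).1 ab) => ->.
  have [_ _ [pi|[pi Ii]]] := pI i; first by rewrite {1}/q pi; exact: degenerate.
  have [_ _ [pj|[pj Ij]]] := pI j.
    by rewrite nonoverlappingC {1}/q pj; exact: degenerate.
  apply: clamp_nonoverlapping; apply: disjoint_nonoverlapping => //.
  apply/seteqP; split=> // x [/Ii Iix /Ij Ijx].
  have /trivIsetP/(_ i j Logic.I Logic.I) := @open_disjoint_itv_trivIset R U oU.
  by rewrite ltn_eqF// => /(_ isT) <-; split.
rewrite -lte_fin; apply: le_lt_trans Ud; rewrite lamU.
apply: le_trans (nneseries_lim_ge n _) => //.
rewrite /total_length big_map -sumEFin /index_iota subn0; apply: lee_sum => k _.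
by have [-> _ _] := pI k; rewrite lee_fin clamp_lipschitz.
Qed.

End null_sets.

(** * The fundamental theorem of calculus for absolutely continuous functions *)

Section density.
Context {R : realType}.
Implicit Types (a b : R) (g H : R -> R) (l : seq (R * R)).
Local Notation mu := (@lebesgue_measure R).

(** The Stieltjes measure of [H] is absolutely continuous with respect to
    Lebesgue measure by [small_increments_null]; its Radon-Nikodym derivative is
    the density. *)
Lemma nondecreasing_density a b H : a <= b ->
  {in `[a, b] &, nondecreasing_fun H} -> small_increments a b H ->
  exists2 phi : R -> R, mu.-integrable setT (EFin \o phi) &
    forall x, a <= x -> x <= b -> H x - H a = \int[mu]_(t in `[a, x]) phi t.
Proof.
move=> ab ndH Hac.
pose F0 := H \o clamp a b.
have ndF : nondecreasing F0.
  by move=> x y xy; apply: ndH; rewrite ?in_itv/= ?clamp_itv ?clamp_homo.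
have rcF : right_continuous F0.
  exact/right_continuousW/small_increments_continuous.
pose F : cumulative R R := HB.pack F0 (isCumulative.Build R _ R F0 ndF rcF).
pose D : set (measurableTypeR R) := `]a, b]%classic.
have mD : measurable D by exact: (@measurable_itv R `]a, b]).
have nuD : (lebesgue_stieltjes_measure F D < +oo)%E.
  by rewrite lebesgue_stieltjes_itvoc// ltry.
pose nu : {finite_measure set (measurableTypeR R) -> \bar R} := mfrestr mD nuD.
have numu : nu `<< mu.
  apply/null_content_dominatesP => A mA A0.
  rewrite /nu/= /mfrestr /mrestr/=.
  apply: (small_increments_null ab Hac) => //; first exact: measurableI.
  apply: (@subset_measure0 _ _ _ mu _ A) => //; first exact: measurableI.
have [f [f0 ffin intf nuE]] := radon_nikodym_sigma_finite numu.
have fE : EFin \o (fine \o f) = f by apply/funext => x /=; rewrite fineK.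
exists (fine \o f); first by rewrite fE.
move=> x ax xb.
rewrite -Rintegral_itv_obnd_cbnd; last first.
  by rewrite fE; apply: integrableS intf => //; exact: (@measurable_itv R `]a, x]).
have := nuE `]a, x]%classic (@measurable_itv R `]a, x]).
rewrite /Rintegral; under [in _ -> _]eq_integral do rewrite fineK//.
move=> <-; rewrite /nu/= /mfrestr /mrestr/=.
rewrite setIidl; last first.
  by move=> t /=; rewrite /D/= !in_itv/= => /andP[-> /le_trans]; apply.
by rewrite lebesgue_stieltjes_itvoc//= /F0/= !clamp_id.
Qed.

Lemma ac_density a b g : a <= b -> absolutely_continuous a b g ->
  exists2 phi : R -> R, mu.-integrable setT (EFin \o phi) &
    forall x, a <= x -> x <= b -> g x - g a = \int[mu]_(t in `[a, x]) phi t.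
Proof.
move=> ab /absolutely_continuous_small_increments gac.
have [V [ndV ndVg Vac Vgac]] := small_increments_split ab gac.
have [v iv vE] := nondecreasing_density ab ndV Vac.
have [w iw wE] := nondecreasing_density ab ndVg Vgac.
exists (v \- w); first exact: (@integrableB _ _ _ mu setT measurableT _ _ iv iw).
move=> x ax xb; rewrite RintegralB; last 3 first.
- exact: (@measurable_itv R `[a, x]).
- by apply: integrableS iv => //; exact: (@measurable_itv R `[a, x]).
- by apply: integrableS iw => //; exact: (@measurable_itv R `[a, x]).
by rewrite -vE// -wE//=; ring.
Qed.

(** The fundamental theorem of calculus for absolutely continuous functions: the
    density is recovered as derivative at almost every point by Lebesgue's
    differentiation theorem. *)
Lemma ac_derivative a b g : a <= b -> absolutely_continuous a b g ->
  exists phi : R -> R, [/\ mu.-integrable setT (EFin \o phi),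
    g b - g a = \int[mu]_(t in `[a, b]) phi t &
    {ae mu, forall x, a < x -> x < b -> is_derive x 1 g (phi x)}].
Proof.
move=> ab /(ac_density ab)[phi iphi gE].
exists phi; split => //; first exact: gE.
have locphi : locally_integrable setT phi.
  by apply: open_integrable_locally => //; exact: openT.
have iphi' y : mu.-integrable [set` Interval (BLeft a) (BRight y)] (EFin \o phi).
  by apply: integrableS iphi => //; exact: (@measurable_itv R `[a, y]).
have := FTC1 iphi' locphi.
apply: (@filterS _ _ (ae_filter_ringOfSetsType mu)) => x + ax xb.
rewrite lte_fin => /(_ ax)[dF F'].
pose G y := \int[mu]_(t in `[a, y]) phi t.
have dG : is_derive x 1 G (phi x) by apply: DeriveDef => //; rewrite -derive1E.
have : is_derive x 1 (cst (g a) + G) (phi x).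
  by apply: is_derive_eq; rewrite add0r.
apply: near_eq_is_derive.
have : \forall y \near x, y \in `]a, b[.
  by apply: near_in_itvoo; rewrite in_itv/= ax.
apply: filterS => y; rewrite in_itv/= => /andP[ay yb].
by rewrite fctE /G -gE ?ltW//=; ring.
Qed.

End density.

(** * Integration by parts *)

Section parts.
Context {R : realType}.
Implicit Types (a b : R) (f g p u v phi : R -> R).
Local Notation mu := (@lebesgue_measure R).

Lemma lipschitz_ac a b f M :
  (forall s t, a <= s -> s <= t -> t <= b -> `|f t - f s| <= M * (t - s)) ->
  absolutely_continuous a b f.
Proof.
move=> fM e e0; have M0 : 0 < `|M| + 1 by rewrite ltr_wpDl.
exists (e / (`|M| + 1)); first by rewrite divr_gt0.
move=> n s t st _; rewrite ltr_pdivlMr// mulrC mulr_sumr; apply: le_lt_trans.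
apply: ler_sum => i _; have [as_ [sti tb]] := st i.
rewrite (le_trans (fM _ _ as_ sti tb))// ler_wpM2r ?subr_ge0//.
by rewrite (le_trans (ler_norm M))// lerDl.
Qed.

Lemma ac_mul_lipschitz a b p g L P G :
  (forall x, a <= x -> x <= b -> `|p x| <= P) ->
  (forall x, a <= x -> x <= b -> `|g x| <= G) ->
  (forall s t, a <= s -> s <= t -> t <= b -> `|p t - p s| <= L * (t - s)) ->
  absolutely_continuous a b g -> absolutely_continuous a b (fun x => p x * g x).
Proof.
move=> pP gG pL gac e e0.
have P0 : 0 < `|P| + 1 by rewrite ltr_wpDl.
have GL0 : 0 < `|G * L| + 1 by rewrite ltr_wpDl.
have [|d d0 gd] := gac (e / 2 / (`|P| + 1)); first by rewrite !divr_gt0.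
exists (Num.min d (e / 2 / (`|G * L| + 1))).
  by rewrite lt_min d0 !divr_gt0.
move=> n s t st tr; rewrite lt_min => /andP[/(gd n s t st tr)].
rewrite !ltr_pdivlMr// => gsum lsum.
apply: (@le_lt_trans _ _ ((\sum_(i < n) `|g (t i) - g (s i)|) * (`|P| + 1) +
    (\sum_(i < n) (t i - s i)) * (`|G * L| + 1))); last by lra.
rewrite !mulr_suml -big_split/=; apply: ler_sum => i _.
have [as_ [sti tb]] := st i.
have -> : p (t i) * g (t i) - p (s i) * g (s i) =
  (g (t i) - g (s i)) * p (t i) + g (s i) * (p (t i) - p (s i)) by ring.
set K := `|G * L|; rewrite (le_trans (ler_normD _ _))// !normrM; apply: lerD.
  rewrite ler_wpM2l// (le_trans (pP _ _ tb)) ?(le_trans as_)//.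
  by rewrite (le_trans (ler_norm P))// lerDl.
have Gs := gG _ as_ (le_trans sti tb).
rewrite (le_trans (ler_pM _ _ Gs (pL _ _ as_ sti tb)))//.
rewrite mulrA [leRHS]mulrC ler_wpM2r ?subr_ge0//.
by apply: (le_trans (ler_norm _)); rewrite lerDl.
Qed.

Lemma within_continuous_bounded a b f : a <= b ->
  {within `[a, b], continuous f} ->
  exists M, forall x, a <= x -> x <= b -> `|f x| <= M.
Proof.
move=> ab cf; have [c _ cM] := EVT_max ab cf; have [d _ dm] := EVT_min ab cf.
exists (`|f c| + `|f d|) => x ax xb.
have xab : x \in `[a, b] by rewrite in_itv/= ax.
have := cM _ xab; have := dm _ xab; have := ler_norm (f c).
have := lerNnormlW (lexx `|f d|).
rewrite ler_norml => *; apply/andP; split; have := normr_ge0 (f d);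
  have := normr_ge0 (f c); lra.
Qed.

Lemma lipschitz_of_derivative a b f (d : R -> R) M :
  {within `[a, b], continuous f} ->
  (forall x, a < x -> x < b -> is_derive x 1 f (d x)) ->
  (forall x, a <= x -> x <= b -> `|d x| <= M) ->
  forall s t, a <= s -> s <= t -> t <= b -> `|f t - f s| <= M * (t - s).
Proof.
move=> cf df dM s t as_ st tb.
have [x|c|c csd ->] := @MVT_segment R f d s t st.
- rewrite in_itv/= => /andP[sx xt]; apply: df; first exact: le_lt_trans sx.
  exact: lt_le_trans tb.
- apply: (continuous_subspaceW _ cf) => x /=; rewrite !in_itv/= => /andP[sx xt].
  by rewrite (le_trans as_)// (le_trans xt).
- rewrite normrM (ger0_norm (x := t - s)) ?subr_ge0// ler_wpM2r ?subr_ge0//.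
  move: csd; rewrite in_itv/= => /andP[sc ct].
  by apply: dM; [exact: le_trans sc|exact: le_trans tb].
Qed.

Lemma ac_continuous a b g : a <= b -> absolutely_continuous a b g ->
  {within `[a, b], continuous g}.
Proof.
move=> ab /absolutely_continuous_small_increments gac.
have := @continuous_subspaceT _ _ `[a, b] _ (small_increments_continuous ab gac).
apply: subspace_eq_continuous => x; rewrite inE/= in_itv/= => /andP[ax xb].
exact: (congr1 g (clamp_id ax xb)).
Qed.

Lemma within_continuous_integrable a b f : {within `[a, b], continuous f} ->
  mu.-integrable `[a, b] (EFin \o f).
Proof.
by move=> cf; apply: continuous_compact_integrable cf; exact: segment_compact.
Qed.

Lemma integrable_continuousM a b f phi : a <= b ->
  {within `[a, b], continuous f} -> mu.-integrable `[a, b] (EFin \o phi) ->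
  mu.-integrable `[a, b] (EFin \o (fun x => f x * phi x)).
Proof.
move=> ab cf iphi.
have [M fM] := within_continuous_bounded ab cf.
apply: (integrableMr _ _ _ iphi).
- exact: (@measurable_itv R `[a, b]).
- by apply: subspace_continuous_measurable_fun => //; exact: measurable_itv.
- exists M; split; first exact: num_real.
  move=> m Mm x /=; rewrite in_itv/= => /andP[ax xb].
  exact: le_trans (fM _ ax xb) (ltW Mm).
Qed.

Lemma ae_eq_Rintegral a b u v :
  mu.-integrable `[a, b] (EFin \o u) -> mu.-integrable `[a, b] (EFin \o v) ->
  {ae mu, forall x, a < x -> x < b -> u x = v x} ->
  \int[mu]_(x in `[a, b]) u x = \int[mu]_(x in `[a, b]) v x.
Proof.
move=> iu iv uv.
have oo w : mu.-integrable `[a, b] (EFin \o w) ->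
    [/\ mu.-integrable `]a, b[ (EFin \o w), mu.-integrable `[a, b[ (EFin \o w) &
    \int[mu]_(x in `[a, b]) w x = \int[mu]_(x in `]a, b[) w x].
  move=> iw.
  have iwco : mu.-integrable `[a, b[ (EFin \o w).
    apply: integrableS iw; [exact: measurable_itv..|].
    exact: subset_itv_co_cc.
  have iwoo : mu.-integrable `]a, b[ (EFin \o w).
    apply: integrableS iw; [exact: measurable_itv..|].
    exact: subset_itv_oo_cc.
  by rewrite -Rintegral_itv_bndo_bndc// -Rintegral_itv_obnd_cbnd.
have [iu' _ ->] := oo _ iu; have [iv' _ ->] := oo _ iv.
congr fine; apply: ae_eq_integral.
- exact: measurable_itv.
- exact: measurable_int iu'.
- exact: measurable_int iv'.
- apply: (@filterS _ _ (ae_filter_ringOfSetsType mu)) uv => x + /=.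
  by rewrite in_itv/= => + /andP[ax xb] => ->.
Qed.

(** The product [p * g] is absolutely continuous, hence the integral of its almost
    everywhere derivative [p * phi + p' * g]. *)
Lemma ac_integration_by_parts a b p (p' : R -> R) g phi : a <= b ->
  (forall x : R, is_derive x 1 p (p' x)) -> continuous p' ->
  absolutely_continuous a b g ->
  mu.-integrable `[a, b] (EFin \o phi) ->
  {ae mu, forall x, a < x -> x < b -> is_derive x 1 g (phi x)} ->
  \int[mu]_(x in `[a, b]) (p x * phi x) =
  p b * g b - p a * g a - \int[mu]_(x in `[a, b]) (p' x * g x).
Proof.
move=> ab dp cp' gac iphi dg.
have cp : {within `[a, b], continuous p}.
  apply: continuous_subspaceT => x.
  by apply: differentiable_continuous; apply/derivable1_diffP; case: (dp x).
have cp'w : {within `[a, b], continuous p'} by exact: continuous_subspaceT.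
have cg := ac_continuous ab gac.
have [L p'L] := within_continuous_bounded ab cp'w.
have [P pP] := within_continuous_bounded ab cp.
have [G gG] := within_continuous_bounded ab cg.
have pgac : absolutely_continuous a b (fun x => p x * g x).
  apply: ac_mul_lipschitz pP gG _ gac.
  by apply: lipschitz_of_derivative cp _ p'L => x _ _; exact: dp.
have [psi [ipsi psiE dpsi]] := ac_derivative ab pgac.
have ipphi := integrable_continuousM ab cp iphi.
have ip'g : mu.-integrable `[a, b] (EFin \o (fun x => p' x * g x)).
  by apply: integrable_continuousM => //; exact: within_continuous_integrable.
have iab : mu.-integrable `[a, b] (EFin \o psi).
  by apply: integrableS ipsi => //; exact: measurable_itv.
have mab : measurable (`[a, b] : set (measurableTypeR R)).
  exact: (@measurable_itv R `[a, b]).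
rewrite psiE -[LHS](addrK (\int[mu]_(x in `[a, b]) (p' x * g x))); congr (_ - _).
rewrite -(RintegralD mab ipphi ip'g).
apply: ae_eq_Rintegral => //; first exact: (integrableD mab ipphi ip'g).
apply: (@filterS2 _ _ (ae_filter_ringOfSetsType mu) _ _ _ _ dpsi dg).
move=> x dpx dgx ax xb.
have := derive_val (is_derive := dpx ax xb).
have dpgx : is_derive x 1 (p * g) (p x * phi x + g x * p' x).
  by have := dgx ax xb; have := dp x => ? ?; exact: is_deriveM.
by have -> := derive_val (is_derive := dpgx); rewrite mulrC (mulrC (p' x)).
Qed.

End parts.

(** * Derivatives relative to a segment *)

Section within_derivative.
Context {R : realType}.
Implicit Types (a b x l : R) (f g : R -> R).
Local Notation mu := (@lebesgue_measure R).

Lemma slope_cvgP f x l :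
  (fun y => (f y - f x) / (y - x)) @ x^' --> l <-> is_derive x 1 f l.
Proof.
split => [fl|/is_derive1_caratheodory[g [gE cg <-]]].
  apply/is_derive1_caratheodory.
  exists (fun y => if y == x then l else (f y - f x) / (y - x)); split.
  - move=> y; case: eqVneq => [->|yx]; first by rewrite !subrr mulr0.
    by rewrite divfK// subr_eq0.
  - apply/continuous_withinNx; rewrite /= eqxx.
    apply: cvg_trans fl; apply: near_eq_cvg; near=> y.
    rewrite ifN//; near: y; exact: nbhs_dnbhs_neq.
  - by rewrite eqxx.
have /continuous_withinNx := cg.
apply: cvg_trans; apply: near_eq_cvg; near=> y.
rewrite gE mulfK// subr_eq0; near: y; exact: nbhs_dnbhs_neq.
Unshelve. all: by end_near. Qed.

Lemma slope_within_cvg a b f x l : is_derive x 1 f l ->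
  slope_within a b f x --> l.
Proof.
by move=> /slope_cvgP; apply: cvg_trans; apply: cvg_app; exact: cvg_within.
Qed.

Lemma slope_within_interior a b f x l : a < x -> x < b ->
  slope_within a b f x --> l -> is_derive x 1 f l.
Proof.
move=> ax xb fl; apply/slope_cvgP; apply: cvg_trans fl; apply: cvg_app.
have xab : \forall y \near x^', y \in `]a, b[.
  by apply: nbhs_dnbhs; apply: near_in_itvoo; rewrite in_itv/= ax.
move=> A wA; have {}wA : x^' (fun y => `[a, b]%classic y -> A y) := wA.
apply: (@filterS2 _ x^' _ _ _ A _ wA xab) => y yA yab; apply: yA.
exact: subset_itv_oo_cc.
Qed.

(** Every point of [[a, b]] is a limit of other points of [[a, b]], which makes
    limits of slopes, one-sided ones included, unique. *)
Lemma within_dnbhs_proper a b x : a < b -> a <= x -> x <= b ->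
  ProperFilter (within `[a, b] x^').
Proof.
move=> ab ax xb; split; last exact: within_filter.
move=> -[e/= e0 he].
have [xltb|bx] := ltP x b.
- apply: (he (Num.min b (x + e / 2))) => /=.
  + rewrite distrC; case: (leP b (x + e / 2)) => ?; rewrite gtr0_norm; lra.
  + by rewrite gt_eqF// lt_min xltb ltrDl divr_gt0.
  + rewrite in_itv/=; case: (leP b (x + e / 2)) => ?; apply/andP; split; lra.
- apply: (he (Num.max a (x - e / 2))) => /=.
  + case: (leP a (x - e / 2)) => ?; rewrite gtr0_norm; lra.
  + rewrite lt_eqF// gt_max; apply/andP; split; lra.
  + rewrite in_itv/=; case: (leP a (x - e / 2)) => ?; apply/andP; split; lra.
Qed.

Lemma slope_within_congr a b f g x : a <= x -> x <= b ->
  {in `[a, b], f =1 g} -> slope_within a b g x --> slope_within a b f x.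
Proof.
move=> ax xb fg; apply: (@fmap_within_eq _ `[a, b]) => y; rewrite inE/= => yab.
by rewrite !fg// in_itv/= ax.
Qed.

Lemma derivative_within_congr a b f g x l : a < b -> a <= x -> x <= b ->
  {in `[a, b], f =1 g} -> is_derive x 1 g l ->
  slope_within a b f x --> l /\ derivative_within a b f x = l.
Proof.
move=> ab ax xb fg gl; have ? := within_dnbhs_proper ab ax xb.
have fl : slope_within a b f x --> l.
  apply: cvg_trans (@slope_within_cvg a b g x l gl).
  apply: slope_within_congr => // y yab; exact/esym/fg.
by split => //; apply: cvg_lim; [exact: Rhausdorff|exact: fl].
Qed.

Lemma derivative_withinE a b f x l : a < b -> a <= x -> x <= b ->
  is_derive x 1 f l -> derivative_within a b f x = l.
Proof.
move=> ab ax xb fl.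
by case: (derivative_within_congr ab ax xb (fun y _ => erefl (f y)) fl).
Qed.

Lemma differentiable_within_is_derive a b f x : differentiable_within a b f ->
  a < x -> x < b -> is_derive x 1 f (derivative_within a b f x).
Proof.
move=> df ax xb; apply: (slope_within_interior ax xb).
by apply: df; rewrite in_itv/= !ltW.
Qed.

Lemma differentiable_within_continuous a b f : differentiable_within a b f ->
  {within `[a, b], continuous f}.
Proof.
move=> df; apply/subspace_continuousP => x xab.
have fx : slope_within a b f x --> derivative_within a b f x by exact: df.
have : (fun y => (f y - f x) / (y - x) * (y - x)) @ within `[a, b] x^' -->
    derivative_within a b f x * (x - x).
  apply: cvgM => //; apply: cvgB; last exact: cvg_cst.
  apply: cvg_trans (cvg_within _ (F := x^')) _.
  exact: nbhs_dnbhs.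
rewrite subrr mulr0 => /cvgr0Pnorm_lt f0.
apply/cvgrPdist_lt => e e0.
have f0e : nbhs x (fun y => y != x -> `[a, b]%classic y ->
  `|(f y - f x) / (y - x) * (y - x)| < e) := f0 e e0.
change (nbhs x (fun y => `[a, b]%classic y -> `|f x - f y| < e)).
apply: (@filterS _ (nbhs x) _ _ _ _ f0e) => y yx yab; rewrite distrC.
have [->|ynx] := eqVneq y x; first by rewrite subrr normr0.
by have := yx ynx yab; rewrite divfK// subr_eq0.
Qed.

End within_derivative.

(** * Integrals of functions of the distance to the endpoints *)

Section tent.
Context {R : realType}.
Implicit Types (a b x l : R) (f g : R -> R).
Local Notation mu := (@lebesgue_measure R).

Lemma is_derive_monomial (n : nat) (k x : R) :
  is_derive x 1 (fun t => k * t ^+ n.+1) (k * (n.+1%:R * x ^+ n)).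
Proof.
have dX : is_derive x (1 : R) (fun t : R => t ^+ n.+1) (n.+1%:R * x ^+ n).
  apply: DeriveDef; first exact: exprn_derivable.
  by rewrite exp_derive; exact: mulr1.
exact: (is_deriveZ k dX).
Qed.

(** The square of a centred quadratic kernel is a quartic; its antiderivative is
    the polynomial of largest degree to be differentiated below. *)
Lemma is_derive_quintic (k1 k2 k3 k4 k5 x : R) :
  is_derive x 1
    (fun t => k1 * t + k2 * t ^+ 2 + k3 * t ^+ 3 + k4 * t ^+ 4 + k5 * t ^+ 5)
    (k1 + 2 * k2 * x + 3 * k3 * x ^+ 2 + 4 * k4 * x ^+ 3 + 5 * k5 * x ^+ 4).
Proof.
have D := is_derive_monomial.
apply: (@is_derive_eq _ _ _ _ _ _ _ _ (is_deriveD (is_deriveD (is_deriveD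
  (is_deriveD (D 0%N k1 x) (D 1%N k2 x)) (D 2%N k3 x)) (D 3%N k4 x))
  (D 4%N k5 x))).
by rewrite expr0 expr1; ring.
Qed.

Lemma is_derive_shift a x f l : is_derive (x - a) 1 f l ->
  is_derive x 1 (fun t => f (t - a)) l.
Proof.
move=> fl; have ds : is_derive x 1 (fun t : R => t - a) 1.
  exact: (@is_derive_eq _ _ _ _ _ _ _ _
    (is_deriveB (is_derive_id x 1) (is_derive_cst a x 1)) (subr0 1)).
by have := @is_derive1_comp _ f (fun t => t - a) x _ _ fl ds; rewrite mulr1.
Qed.

Lemma is_derive_reflect b x f l : is_derive (b - x) 1 f l ->
  is_derive x 1 (fun t => f (b - t)) (- l).
Proof.
move=> fl; have ds : is_derive x 1 (fun t : R => b - t) (-1).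
  exact: (@is_derive_eq _ _ _ _ _ _ _ _
    (is_deriveB (is_derive_cst b x 1) (is_derive_id x 1)) (sub0r 1)).
by have := @is_derive1_comp _ f (fun t => b - t) x _ _ fl ds; rewrite mulrN1.
Qed.

Lemma is_derive_continuous f (d : R -> R) :
  (forall x : R, is_derive x 1 f (d x)) -> continuous f.
Proof.
move=> df x; apply: differentiable_continuous; apply/derivable1_diffP.
by case: (df x).
Qed.

Lemma Rintegral_derive (F F' : R -> R) a b : a < b ->
  (forall x : R, is_derive x 1 F (F' x)) -> continuous F' ->
  \int[mu]_(t in `[a, b]) F' t = F b - F a.
Proof.
move=> ab dF cF'; have cF := is_derive_continuous dF.
rewrite /Rintegral (@continuous_FTC2 _ _ F)//.
- exact: continuous_subspaceT.
- split; first by move=> x _; case: (dF x).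
    exact: cvg_at_right_filter (cF a).
  exact: cvg_at_left_filter (cF b).
- by move=> x _; rewrite derive1E; have := dF x => ?; rewrite derive_val.
Qed.

Lemma Rintegral_split a b c f : a <= c -> c <= b ->
  mu.-integrable `[a, b] (EFin \o f) ->
  \int[mu]_(t in `[a, b]) f t =
  \int[mu]_(t in `[a, c]) f t + \int[mu]_(t in `[c, b]) f t.
Proof.
move=> ac cb fi; rewrite -[X in _ + X]Rintegral_itv_obnd_cbnd; last first.
  apply: integrableS fi; [exact: measurable_itv..|].
  by move=> t/=; rewrite !in_itv/= => /andP[/ltW/(le_trans ac) -> ->].
by rewrite -(@Rintegral_itvB _ _ (BLeft a) (BRight b) c)//; ring.
Qed.

(** The distance to the nearest endpoint, for points of [[a, b]]. Functions of it
    are symmetric about the midpoint, as the Peano kernel is, so that a single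
    polynomial describes the kernel on both halves. *)
Definition tent a b t : R := (b - a) / 2 - `|t - (a + b) / 2|.

Lemma tentE_left a b t : t <= (a + b) / 2 -> tent a b t = t - a.
Proof. by move=> tc; rewrite /tent distrC ger0_norm ?subr_ge0//; field. Qed.

Lemma tentE_right a b t : (a + b) / 2 <= t -> tent a b t = b - t.
Proof. by move=> tc; rewrite /tent ger0_norm ?subr_ge0//; field. Qed.

Lemma tent_continuous a b : continuous (tent a b).
Proof.
move=> x; apply: cvgB; first exact: cvg_cst.
by apply: cvg_norm; apply: cvgB; [exact: cvg_id|exact: cvg_cst].
Qed.

Lemma Rintegral_tent (G g : R -> R) a b : a < b ->
  (forall x : R, is_derive x 1 G (g x)) -> continuous g ->
  \int[mu]_(t in `[a, b]) g (tent a b t) = 2 * (G ((b - a) / 2) - G 0).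
Proof.
move=> ab dG cg; set c := (a + b) / 2.
have [ac cb] : a < c /\ c < b by rewrite /c; split; lra.
have cgt : continuous (g \o tent a b).
  by move=> x; apply: continuous_comp; [exact: tent_continuous|exact: cg].
rewrite (Rintegral_split (ltW ac) (ltW cb)); last first.
  by apply: within_continuous_integrable; exact: continuous_subspaceT.
have -> : \int[mu]_(t in `[a, c]) g (tent a b t) =
    \int[mu]_(t in `[a, c]) g (t - a).
  apply: eq_Rintegral => t; rewrite inE/= in_itv/= => /andP[_ tc].
  by rewrite tentE_left.
have -> : \int[mu]_(t in `[c, b]) g (tent a b t) =
    \int[mu]_(t in `[c, b]) - (- g (b - t)).
  apply: eq_Rintegral => t; rewrite inE/= in_itv/= => /andP[ct _].
  by rewrite opprK tentE_right.
have -> : \int[mu]_(t in `[a, c]) g (t - a) = G (c - a) - G (a - a).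
  apply: (@Rintegral_derive (fun t => G (t - a))) => // x.
    exact: is_derive_shift.
  apply: (@continuous_comp _ _ _ (fun t => t - a)); last exact: cg.
  by apply: cvgB; [exact: cvg_id|exact: cvg_cst].
have -> : \int[mu]_(t in `[c, b]) - (- g (b - t)) = - G (b - b) - - G (b - c).
  apply: (@Rintegral_derive (fun t => - G (b - t))) => // x.
    exact: (is_deriveN (is_derive_reflect (dG (b - x)))).
  rewrite /continuous_at opprK; under eq_fun do rewrite opprK.
  apply: (@continuous_comp _ _ _ (fun t => b - t)); last exact: cg.
  by apply: cvgB; [exact: cvg_cst|exact: cvg_id].
have -> : c - a = (b - a) / 2 by rewrite /c; field.
have -> : b - c = (b - a) / 2 by rewrite /c; field.
by rewrite !subrr; ring.
Qed.

End tent.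

(** * The Peano kernel of the quadrature formula *)

Section peano.
Context {R : realType}.
Implicit Types (a b s t x l : R) (f g p : R -> R).
Local Notation mu := (@lebesgue_measure R).

Lemma ac_subitv a b s t g : a <= s -> t <= b ->
  absolutely_continuous a b g -> absolutely_continuous s t g.
Proof.
move=> as_ tb gac e /gac[d d0 gd]; exists d => // n u v uv; apply: gd => i.
by have [su [-> vt]] := uv i; rewrite (le_trans as_ su) (le_trans vt tb).
Qed.

Lemma square_integrable_integrable a b g : square_integrable a b g ->
  mu.-integrable `[a, b] (EFin \o g) /\
  mu.-integrable `[a, b] (EFin \o (fun x => g x ^+ 2)).
Proof.
move=> g2; have mab : measurable (`[a, b] : set (measurableTypeR R)).
  exact: (@measurable_itv R `[a, b]).
have mg : measurable_fun `[a, b] g.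
  apply/(measurable_restrictT _ mab).
  exact: (set_mem (sub_Lfun_mfun g2)).
have ig2 : mu.-integrable `[a, b] (EFin \o (fun x => g x ^+ 2)).
  rewrite integrable_mkcond// restrict_EFin.
  have := Lfun2_integrable_sqr g2; congr (_.-integrable _ _).
  apply/funext => x/=; congr EFin; rewrite !patchE; case: ifP => //.
  by rewrite expr0n.
split => //.
(* On a segment of finite length |g| is dominated by 1 + g ^ 2. *)
have i1 : mu.-integrable `[a, b] (EFin \o cst 1).
  apply: within_continuous_integrable; apply: continuous_subspaceT => x.
  exact: cvg_cst.
apply: le_integrable (integrableD mab i1 ig2) => //.
  exact/measurable_EFinP.
move=> x _ /=; rewrite lee_fin [leRHS]ger0_norm; last by rewrite addr_ge0 ?sqr_ge0.
have := sqr_ge0 (`|g x| - 1); rewrite -(real_normK (num_real (g x))) => ?.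
have := normr_ge0 (g x); nra.
Qed.

(** Two integrations by parts; the hypothesis [p'' = 1] leaves the integral of [f]
    itself, the main term of a quadrature error. *)
Lemma ac_second_by_parts a b s t f f1 f2 p (p' : R -> R) :
  a <= s -> s <= t -> t <= b ->
  absolutely_continuous a b f -> absolutely_continuous a b f1 ->
  (forall x, a < x -> x < b -> is_derive x 1 f (f1 x)) ->
  {ae mu, forall x, a < x -> x < b -> is_derive x 1 f1 (f2 x)} ->
  mu.-integrable `[a, b] (EFin \o f2) ->
  (forall x : R, is_derive x 1 p (p' x)) ->
  (forall x : R, is_derive x 1 p' 1) ->
  \int[mu]_(x in `[s, t]) (p x * f2 x) =
  p t * f1 t - p s * f1 s - (p' t * f t - p' s * f s)
  + \int[mu]_(x in `[s, t]) f x.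
Proof.
move=> as_ st tb fac f1ac df df1 if2 dp dp'.
have ab : a <= b := le_trans as_ (le_trans st tb).
have facst := ac_subitv as_ tb fac; have f1acst := ac_subitv as_ tb f1ac.
have sub : `[s, t]%classic `<=` `[a, b]%classic.
  by move=> x/=; rewrite !in_itv/= => /andP[/(le_trans as_)-> /le_trans->].
rewrite (ac_integration_by_parts st dp _ f1acst); last 3 first.
- exact: is_derive_continuous dp'.
- by apply: integrableS if2 => //; exact: measurable_itv.
- apply: (@filterS _ _ (ae_filter_ringOfSetsType mu)) df1 => x + sx xt; apply.
    exact: le_lt_trans sx.
  exact: lt_le_trans tb.
rewrite (ac_integration_by_parts st dp' _ facst); last 3 first.
- by move=> x; exact: cvg_cst.
- by apply: within_continuous_integrable; exact: ac_continuous.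
- apply: aeW => x sx xt; apply: df.
    exact: le_lt_trans sx.
  exact: lt_le_trans tb.
by under [in LHS]eq_Rintegral do rewrite mul1r; ring.
Qed.

(** The polynomial vanishing at 0, with second derivative 1, whose derivative at 0
    is minus the weight given to an endpoint by the quadrature formula on an
    interval of length [h]. *)
Definition peano_profile (h u : R) : R := u ^+ 2 / 2 - Num.sqrt 2 / 8 * h * u.

Definition peano_kernel a b t : R := peano_profile (b - a) (tent a b t).

Lemma is_derive_quadratic (k1 k2 x : R) :
  is_derive x 1 (fun t => k1 * t ^+ 2 + k2 * t) (2 * k1 * x + k2).
Proof.
apply: (@is_derive_eq _ _ _ _ _ _ _ _ (is_deriveD (is_derive_monomial 1 k1 x)
  (is_derive_monomial 0 k2 x))).
by rewrite expr0 expr1; ring.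
Qed.

Lemma is_derive_peano_profile (h u : R) :
  is_derive u 1 (peano_profile h) (u - Num.sqrt 2 / 8 * h).
Proof.
have := is_derive_quadratic 2^-1 (- (Num.sqrt 2 / 8 * h)) u.
rewrite mulfV// mul1r; congr (is_derive _ _ _ _).
by apply/funext => t; rewrite /peano_profile; field.
Qed.

Lemma peano_kernel_continuous a b : continuous (peano_kernel a b).
Proof.
move=> x; apply: (@continuous_comp _ _ _ (tent a b) (peano_profile (b - a))).
  exact: tent_continuous.
exact: (is_derive_continuous (is_derive_peano_profile _)).
Qed.

(** Integrating by parts twice on each half: the boundary terms at [a] and [b] are
    the endpoint terms of the formula, since the profile vanishes there; at the
    midpoint the terms in [f1] cancel, the kernel being continuous, and those in
    [f] add up, the derivative of the kernel changing sign there. *)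
Lemma peano_identity a b f f1 f2 : a < b ->
  absolutely_continuous a b f -> absolutely_continuous a b f1 ->
  (forall x, a < x -> x < b -> is_derive x 1 f (f1 x)) ->
  {ae mu, forall x, a < x -> x < b -> is_derive x 1 f1 (f2 x)} ->
  mu.-integrable `[a, b] (EFin \o f2) ->
  \int[mu]_(t in `[a, b]) (peano_kernel a b t * f2 t) = quad_error f a b.
Proof.
move=> ab fac f1ac df df1 if2.
set c := (a + b) / 2; set h := b - a; set k := Num.sqrt 2 / 8 * h.
have [ac cb] : a < c /\ c < b by rewrite /c; split; lra.
have iKf : mu.-integrable `[a, b] (EFin \o (fun t => peano_kernel a b t * f2 t)).
  apply: integrable_continuousM => //; first exact: ltW.
  by apply: continuous_subspaceT; exact: peano_kernel_continuous.
rewrite (Rintegral_split (ltW ac) (ltW cb) iKf).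
have -> : \int[mu]_(t in `[a, c]) (peano_kernel a b t * f2 t) =
    \int[mu]_(t in `[a, c]) (peano_profile h (t - a) * f2 t).
  apply: eq_Rintegral => t; rewrite inE/= in_itv/= => /andP[_ tc].
  by rewrite /peano_kernel tentE_left.
have -> : \int[mu]_(t in `[c, b]) (peano_kernel a b t * f2 t) =
    \int[mu]_(t in `[c, b]) (peano_profile h (b - t) * f2 t).
  apply: eq_Rintegral => t; rewrite inE/= in_itv/= => /andP[ct _].
  by rewrite /peano_kernel tentE_right.
have second := fun s t p p' as_ st tb => @ac_second_by_parts a b s t f f1 f2
  p p' as_ st tb fac f1ac df df1 if2.
have dl (x : R) :
    is_derive x 1 (fun t => peano_profile h (t - a)) (x - a - k).
  by apply: is_derive_shift; exact: is_derive_peano_profile.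
have dl' (x : R) : is_derive x 1 (fun t => t - a - k) 1.
  have := is_derive_shift (a := a + k) (is_derive_id (x - (a + k)) (1 : R)).
  by congr (is_derive _ _ _ _); apply/funext => t; rewrite opprD addrA.
have dr (x : R) :
    is_derive x 1 (fun t => peano_profile h (b - t)) (- (b - x - k)).
  by apply: is_derive_reflect; exact: is_derive_peano_profile.
have dr' (x : R) : is_derive x 1 (fun t => - (b - t - k)) 1.
  have := is_derive_shift (a := b - k) (is_derive_id (x - (b - k)) (1 : R)).
  by congr (is_derive _ _ _ _); apply/funext => t; rewrite /=; ring.
rewrite (second a c _ _ (lexx a) (ltW ac) (ltW cb) dl dl').
rewrite (second c b _ _ (ltW ac) (ltW cb) (lexx b) dr dr').
have ifab : mu.-integrable `[a, b] (EFin \o f).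
  by apply: within_continuous_integrable; apply: ac_continuous => //; exact: ltW.
rewrite /quad_error (Rintegral_split (ltW ac) (ltW cb) ifab).
have -> : c - a = h / 2 by rewrite /c /h; field.
have -> : b - c = h / 2 by rewrite /c /h; field.
by rewrite -/c -/h /k /peano_profile !subrr; field.
Qed.

End peano.

(** * Norm of the centred kernel and the Cauchy-Schwarz inequality *)

Section upper.
Context {R : realType}.
Implicit Types (a b s t x l : R) (f g p k phi : R -> R).
Local Notation mu := (@lebesgue_measure R).

Lemma measurable_segment a b : measurable (`[a, b] : set (measurableTypeR R)).
Proof. exact: (@measurable_itv R `[a, b]). Qed.

Lemma Rintegral_cst_segment a b (r : R) : a <= b ->
  \int[mu]_(t in `[a, b]) r = r * (b - a).
Proof.
move=> ab; rewrite Rintegral_cst; last exact: measurable_segment.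
rewrite [X in _ * fine X]lebesgue_measure_itv/= lte_fin.
by case: ltgtP ab => //= ->; rewrite subrr.
Qed.

Lemma RintegralD_segment a b f g :
  mu.-integrable `[a, b] (EFin \o f) -> mu.-integrable `[a, b] (EFin \o g) ->
  \int[mu]_(t in `[a, b]) (f t + g t) =
  \int[mu]_(t in `[a, b]) f t + \int[mu]_(t in `[a, b]) g t.
Proof. by move=> fi gi; exact: (RintegralD (measurable_segment a b)). Qed.

Lemma RintegralZ_segment a b f (r : R) : mu.-integrable `[a, b] (EFin \o f) ->
  \int[mu]_(t in `[a, b]) (r * f t) = r * \int[mu]_(t in `[a, b]) f t.
Proof. by move=> fi; exact: (RintegralZl _ (measurable_segment a b)). Qed.

Lemma integrableD_segment a b f g :
  mu.-integrable `[a, b] (EFin \o f) -> mu.-integrable `[a, b] (EFin \o g) ->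
  mu.-integrable `[a, b] (EFin \o (fun t => f t + g t)).
Proof. by move=> fi gi; exact: (integrableD (measurable_segment a b) fi gi). Qed.

Lemma integrableZ_segment a b f (r : R) : mu.-integrable `[a, b] (EFin \o f) ->
  mu.-integrable `[a, b] (EFin \o (fun t => r * f t)).
Proof. by move=> fi; exact: (integrableZl (measurable_segment a b) r fi). Qed.

(** The subtracted constant is the mean of the Peano kernel over [[a, b]]; times
    the integral of the second derivative, it is the correction term. *)
Definition mean_zero_kernel a b t : R :=
  peano_kernel a b t - (b - a) ^+ 2 / 96 * (4 - 3 * Num.sqrt 2).

Lemma mean_zero_kernel_continuous a b : continuous (mean_zero_kernel a b).
Proof.
move=> x; apply: cvgB; last exact: cvg_cst.
exact: peano_kernel_continuous.
Qed.

Lemma sqrt2_sqr : Num.sqrt 2 ^+ 2 = 2 :> R.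
Proof. by rewrite sqr_sqrtr. Qed.

Lemma sharp_radicand_gt0 : 0 < 47 / 23040 - Num.sqrt 2 / 768 :> R.
Proof.
have w2 := sqrt2_sqr; have w0 : 0 <= Num.sqrt 2 :> R by exact: sqrtr_ge0.
nra.
Qed.

Lemma sharp_constant_sqr :
  sharp_constant ^+ 2 = 47 / 23040 - Num.sqrt 2 / 768 :> R.
Proof.
rewrite /sharp_constant; apply: sqr_sqrtr; apply: ltW.
exact: sharp_radicand_gt0.
Qed.

Lemma Rintegral_mean_zero_kernel a b : a < b ->
  \int[mu]_(t in `[a, b]) mean_zero_kernel a b t = 0.
Proof.
move=> ab; set h := b - a; set m := h ^+ 2 / 96 * (4 - 3 * Num.sqrt 2).
pose w : R := Num.sqrt 2.
pose G t := (- m) * t + (- (w / 16 * h)) * t ^+ 2 + 6^-1 * t ^+ 3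
  + 0 * t ^+ 4 + 0 * t ^+ 5.
have D (u : R) : is_derive u 1 G (peano_profile h u - m).
  apply: (@is_derive_eq _ _ _ _ _ _ _ _
    (is_derive_quintic (- m) (- (w / 16 * h)) 6^-1 0 0 u)).
  by rewrite /peano_profile -/w; field.
have := Rintegral_tent ab D; rewrite -/h => ->; last first.
  move=> u; apply: cvgB; last exact: cvg_cst.
  exact: (is_derive_continuous (is_derive_peano_profile h)).
by rewrite /G /m -/w; field.
Qed.

Lemma Rintegral_mean_zero_kernel_sqr a b : a < b ->
  \int[mu]_(t in `[a, b]) (mean_zero_kernel a b t ^+ 2)
  = sharp_constant ^+ 2 * (b - a) ^+ 5.
Proof.
move=> ab; set h := b - a; pose w : R := Num.sqrt 2.
pose m := h ^+ 2 / 96 * (4 - 3 * w); pose k := w / 8 * h.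
pose G t := (m ^+ 2) * t + (k * m) * t ^+ 2 + ((k ^+ 2 - m) / 3) * t ^+ 3
  + (- (k / 4)) * t ^+ 4 + 20^-1 * t ^+ 5.
have D (u : R) : is_derive u 1 G ((peano_profile h u - m) ^+ 2).
  apply: (@is_derive_eq _ _ _ _ _ _ _ _ (is_derive_quintic
    (m ^+ 2) (k * m) ((k ^+ 2 - m) / 3) (- (k / 4)) 20^-1 u)).
  by rewrite /peano_profile -/w -/k; field.
have := Rintegral_tent ab D; rewrite -/h => ->; last first.
  move=> u; have cE : continuous (fun u => peano_profile h u - m).
    move=> v; apply: cvgB; last exact: cvg_cst.
    exact: (is_derive_continuous (is_derive_peano_profile h)).
  by apply: (@continuous_comp _ _ _ (fun u => peano_profile h u - m)
    (fun z => z ^+ 2)); [exact: cE|exact: exprn_continuous].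
have w2 : w ^+ 2 * h ^+ 5 = 2 * h ^+ 5 by rewrite sqrt2_sqr.
rewrite sharp_constant_sqr /G -/w /m /k; lra.
Qed.

(** As [k] has mean zero, [phi] may be replaced by [phi] minus its mean, whose
    square has integral [(b - a) * chebyshevT phi a b]; the Cauchy-Schwarz
    inequality follows. *)
Lemma variance_cauchy_schwarz a b k phi : a < b ->
  continuous k -> \int[mu]_(t in `[a, b]) k t = 0 ->
  0 < \int[mu]_(t in `[a, b]) (k t ^+ 2) ->
  mu.-integrable `[a, b] (EFin \o phi) ->
  mu.-integrable `[a, b] (EFin \o (fun t => phi t ^+ 2)) ->
  (\int[mu]_(t in `[a, b]) (k t * phi t)) ^+ 2 <=
  (\int[mu]_(t in `[a, b]) (k t ^+ 2)) * ((b - a) * chebyshevT phi a b).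
Proof.
move=> ab ck k0 kk0 iphi iphi2.
set D := \int[mu]_(t in _) (k t ^+ 2) in kk0 *.
set B := \int[mu]_(t in _) (k t * phi t).
pose I := \int[mu]_(t in `[a, b]) phi t.
pose J := \int[mu]_(t in `[a, b]) (phi t ^+ 2).
have h0 : 0 < b - a by rewrite subr_gt0.
have -> : (b - a) * chebyshevT phi a b = J - I ^+ 2 / (b - a).
  by rewrite /chebyshevT -/I -/J; field; rewrite gt_eqF.
have cint (v : R -> R) : continuous v -> mu.-integrable `[a, b] (EFin \o v).
  by move=> cv; apply: within_continuous_integrable; exact: continuous_subspaceT.
have ik := cint _ ck.
have ik2 : mu.-integrable `[a, b] (EFin \o (fun t => k t ^+ 2)).
  apply: cint => x; apply: (@continuous_comp _ _ _ k (fun z => z ^+ 2)).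
    exact: ck.
  exact: exprn_continuous.
have ikphi : mu.-integrable `[a, b] (EFin \o (fun t => k t * phi t)).
  by apply: integrable_continuousM => //; [exact: ltW|exact: continuous_subspaceT].
(* x * k is the orthogonal projection of phi - m on the line spanned by k. *)
pose m := I / (b - a); pose x := B / D.
have iZ := @integrableZ_segment a b; have iD := @integrableD_segment a b.
have ic (r : R) : mu.-integrable `[a, b] (EFin \o (fun=> r)).
  by apply: cint => y; exact: cvg_cst.
have : 0 <= \int[mu]_(t in `[a, b]) ((phi t - m - x * k t) ^+ 2).
  by apply: Rintegral_ge0 => t _; exact: sqr_ge0.
(* The constant is made opaque, lest it be read as a product r * v t. *)
have [q qE] : exists q, q = m ^+ 2 by exists (m ^+ 2).
have -> : \int[mu]_(t in `[a, b]) ((phi t - m - x * k t) ^+ 2) =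
    \int[mu]_(t in `[a, b]) (phi t ^+ 2 + (- (2 * m) * phi t +
      (- (2 * x) * (k t * phi t) + (q + (2 * x * m * k t + x ^+ 2 * k t ^+ 2))))).
  by apply: eq_Rintegral => t _; rewrite qE; ring.
have j2 := iD _ _ (iZ _ (2 * x * m) ik) (iZ _ (x ^+ 2) ik2).
have j3 := iD _ _ (ic q) j2.
have j4 := iD _ _ (iZ _ (- (2 * x)) ikphi) j3.
have j5 := iD _ _ (iZ _ (- (2 * m)) iphi) j4.
rewrite (RintegralD_segment iphi2 j5).
rewrite (RintegralD_segment (iZ _ (- (2 * m)) iphi) j4).
rewrite (RintegralD_segment (iZ _ (- (2 * x)) ikphi) j3).
rewrite (RintegralD_segment (ic q) j2).
rewrite (RintegralD_segment (iZ _ (2 * x * m) ik) (iZ _ (x ^+ 2) ik2)).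
rewrite !RintegralZ_segment// (Rintegral_cst_segment q (ltW ab)).
rewrite k0 qE -/B -/D -/I -/J.
have -> : J + (- (2 * m) * I + (- (2 * x) * B + (m ^+ 2 * (b - a) +
   (2 * x * m * 0 + x ^+ 2 * D)))) = J - I ^+ 2 / (b - a) - B ^+ 2 / D.
  by rewrite /m /x; field; rewrite !gt_eqF.
by rewrite subr_ge0 ler_pdivrMr// mulrC.
Qed.

End upper.

(** * The upper bound *)

Section bound.
Context {R : realType}.
Implicit Types (a b s t x l : R) (f g p k phi : R -> R).
Local Notation mu := (@lebesgue_measure R).

(** Almost everywhere the two-sided derivative exists, so that almost everywhere
    the limit defining [derivative_within] is a genuine one. *)
Lemma ac_derivative_within a b g : a < b -> absolutely_continuous a b g ->
  {ae mu, forall x, a < x -> x < b ->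
    is_derive x 1 g (derivative_within a b g x)}.
Proof.
move=> ab gac; have [psi [_ _ dg]] := ac_derivative (ltW ab) gac.
apply: (@filterS _ _ (ae_filter_ringOfSetsType mu)) dg => x dg ax xb.
have dgx := dg ax xb.
by rewrite (derivative_withinE ab (ltW ax) (ltW xb) dgx).
Qed.

Lemma differentiable_within_ac a b f : a < b -> differentiable_within a b f ->
  absolutely_continuous a b (derivative_within a b f) ->
  absolutely_continuous a b f.
Proof.
move=> ab df f1ac.
have [M fM] := within_continuous_bounded (ltW ab) (ac_continuous (ltW ab) f1ac).
apply: (lipschitz_ac (M := M)).
apply: lipschitz_of_derivative fM; first exact: differentiable_within_continuous.
by move=> x; exact: differentiable_within_is_derive.
Qed.

(** The correction term is what turns the Peano kernel into its deviation from its
    mean, [derivative_within a b f] being the integral of its derivative. *)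
Lemma deviation_identity a b f : a < b -> admissible a b f ->
  quad_error f a b - quad_correction f a b =
  \int[mu]_(t in `[a, b]) (mean_zero_kernel a b t *
    derivative_within a b (derivative_within a b f) t).
Proof.
move=> ab [df f1ac f2sq]; set f1 := derivative_within a b f in f1ac f2sq *.
set f2 := derivative_within a b f1 in f2sq *.
have [if2 _] := square_integrable_integrable f2sq.
have df1 := ac_derivative_within ab f1ac.
have fac := differentiable_within_ac ab df f1ac.
rewrite -(peano_identity ab fac f1ac _ df1 if2); last first.
  by move=> x; exact: differentiable_within_is_derive.
set m := (b - a) ^+ 2 / 96 * (4 - 3 * Num.sqrt 2).
have if2E : \int[mu]_(t in `[a, b]) f2 t = f1 b - f1 a.
  have := @ac_integration_by_parts _ a b (cst 1) (cst 0) f1 f2 (ltW ab)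
    _ _ f1ac if2 df1.
  rewrite /= !mul1r => H.
  have -> : \int[mu]_(t in `[a, b]) f2 t = \int[mu]_(x in `[a, b]) (1 * f2 x).
    by apply: eq_Rintegral => t _; rewrite mul1r.
  rewrite H//; last by move=> x; exact: cvg_cst.
  rewrite [X in _ - X](_ : _ = 0) ?subr0//.
  have -> : \int[mu]_(x in `[a, b]) (0 * f1 x) = \int[mu]_(x in `[a, b]) 0.
    by apply: eq_Rintegral => t _; rewrite mul0r.
  by rewrite Rintegral_cst_segment ?mul0r// ltW.
have iK : mu.-integrable `[a, b] (EFin \o (fun t => peano_kernel a b t * f2 t)).
  apply: integrable_continuousM => //; first exact: ltW.
  by apply: continuous_subspaceT; exact: peano_kernel_continuous.
have -> : quad_correction f a b = m * (f1 b - f1 a) by [].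
rewrite -if2E -mulNr -(RintegralZ_segment _ if2).
rewrite -(RintegralD_segment iK (integrableZ_segment _ if2)).
by apply: eq_Rintegral => t _; rewrite /mean_zero_kernel -/m; ring.
Qed.

Lemma powR_five_half_sqr (h : R) : 0 < h -> (h `^ (5 / 2)) ^+ 2 = h ^+ 5.
Proof.
move=> h0; rewrite -powR_mulrn ?powR_ge0// -powRrM divfK//.
by rewrite powR_mulrn// ltW.
Qed.

Lemma sharp_bound a b f : a < b -> admissible a b f ->
  quad_bound sharp_constant a b f.
Proof.
move=> ab fadm; rewrite /quad_bound (deviation_identity ab fadm).
have [_ _ /square_integrable_integrable[if2 if2sq]] := fadm.
set f2 := derivative_within a b _ in if2 if2sq *.
have kk := Rintegral_mean_zero_kernel_sqr ab.
have c20 : 0 < sharp_constant ^+ 2 :> R.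
  by rewrite sharp_constant_sqr sharp_radicand_gt0.
have D0 : 0 < sharp_constant ^+ 2 * (b - a) ^+ 5.
  by rewrite mulr_gt0// exprn_gt0// subr_gt0.
have := variance_cauchy_schwarz ab (@mean_zero_kernel_continuous _ a b)
  (Rintegral_mean_zero_kernel ab) _ if2 if2sq.
rewrite kk => /(_ D0) BDA.
have A0 : 0 <= (b - a) * chebyshevT f2 a b.
  by have := le_trans (sqr_ge0 _) BDA; rewrite pmulr_rge0.
have sE : sigma f2 a b ^+ 2 = (b - a) * chebyshevT f2 a b by exact: sqr_sqrtr.
rewrite -ler_sqr ?nnegrE ?normr_ge0//; last first.
  by rewrite !mulr_ge0 ?sqrtr_ge0 ?powR_ge0.
rewrite real_normK ?num_real// (le_trans BDA)// !exprMn.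
rewrite powR_five_half_sqr ?subr_gt0//.
rewrite sE [leRHS]mulrAC; exact: lexx.
Qed.

End bound.

(** * The extremal function *)

Section extremal.
Context {R : realType}.
Implicit Types (a b s t x l : R) (f g p k phi : R -> R).
Local Notation mu := (@lebesgue_measure R).

Lemma continuous_square_integrable a b f g : continuous g ->
  {in `[a, b], f =1 g} -> square_integrable a b f.
Proof.
move=> cg fg; have mab := measurable_segment a b.
have fgE : f \_ `[a, b] = g \_ `[a, b].
  apply/funext => x; rewrite !patchE; case: ifPn => //.
  by rewrite inE/= => xab; rewrite fg.
have mg : measurable_fun setT (g \_ `[a, b]).
  apply/(measurable_restrictT _ mab).
  by apply: measurable_funTS; exact: continuous_measurable_fun.
have ig2 : mu.-integrable `[a, b] (EFin \o (fun x => g x ^+ 2)).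
  apply: within_continuous_integrable; apply: continuous_subspaceT => x.
  by apply: (@continuous_comp _ _ _ g (fun z => z ^+ 2));
    [exact: cg|exact: exprn_continuous].
rewrite /square_integrable fgE inE; apply/andP; split; rewrite inE//=.
rewrite /finite_norm unlock /Lnorm poweR_lty//.
rewrite (_ : (fun x => _) = (EFin \o (fun x => g x ^+ 2)) \_ `[a, b]).
  by rewrite -integral_mkcond; exact: integrable_lty.
apply/funext => x /=; rewrite restrict_EFin/= !patchE; case: ifP => _.
  by rewrite powR_mulrn ?normr_ge0// real_normK// num_real.
by rewrite normr0 powR0.
Qed.

Lemma is_derive_norm_mul x : is_derive x 1 (fun t : R => `|t| * t) (2 * `|x|).
Proof.
have [x0|x0|->] := ltgtP x 0.
- have : is_derive x 1 (fun t : R => - 1 * t ^+ 2) (2 * `|x|).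
    apply: (@is_derive_eq _ _ _ _ _ _ _ _ (is_derive_monomial 1 (-1) x)).
    by rewrite ltr0_norm// expr1; ring.
  apply: near_eq_is_derive; near=> t.
  rewrite ltr0_norm; first by ring.
  by near: t; exact: lt_nbhsl.
- have : is_derive x 1 (fun t : R => 1 * t ^+ 2) (2 * `|x|).
    apply: (@is_derive_eq _ _ _ _ _ _ _ _ (is_derive_monomial 1 1 x)).
    by rewrite gtr0_norm// expr1; ring.
  apply: near_eq_is_derive; near=> t.
  rewrite gtr0_norm; first by ring.
  by near: t; exact: lt_nbhsr.
- apply/is_derive1_caratheodory; exists (fun t => `|t|).
  split; [by move=> z; rewrite normr0 mul0r !subr0| |by rewrite normr0 mulr0].
  exact: norm_continuous.
Unshelve. all: by end_near. Qed.

Lemma is_derive_cubic_norm x :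
  is_derive x 1 (fun t : R => `|t| * t * t) (3 * (`|x| * x)).
Proof.
apply: (@is_derive_eq _ _ _ _ _ _ _ _
  (is_deriveM (is_derive_norm_mul x) (is_derive_id x 1))).
by rewrite /GRing.scale/=; ring.
Qed.

(** In terms of the signed distance [r] to the midpoint, the Peano kernel is
    [k0 + k1 * `|r| + r ^+ 2 / 2]; this function and the next one are its first
    and second antiderivatives. *)
Definition extremal_slope a b t : R :=
  let h := b - a in let r := t - (a + b) / 2 in
  let k0 := h ^+ 2 * (2 - Num.sqrt 2) / 16 in
  let k1 := h * (Num.sqrt 2 / 8 - 2^-1) in
  k0 * r + k1 / 2 * (`|r| * r) + r ^+ 3 / 6.

Definition extremal a b t : R :=
  let h := b - a in let r := t - (a + b) / 2 in
  let k0 := h ^+ 2 * (2 - Num.sqrt 2) / 16 in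
  let k1 := h * (Num.sqrt 2 / 8 - 2^-1) in
  k0 / 2 * r ^+ 2 + k1 / 6 * (`|r| * r * r) + r ^+ 4 / 24.

Lemma is_derive_extremal a b x :
  is_derive x 1 (extremal a b) (extremal_slope a b x).
Proof.
pose c := (a + b) / 2; pose r := x - c.
pose k0 := (b - a) ^+ 2 * (2 - Num.sqrt 2) / 16.
pose k1 := (b - a) * (Num.sqrt 2 / 8 - 2^-1).
have dr : is_derive r 1
  (fun r : R => k0 / 2 * r ^+ 2 + k1 / 6 * (`|r| * r * r) + 24^-1 * r ^+ 4)
  (k0 * r + k1 / 2 * (`|r| * r) + r ^+ 3 / 6).
  apply: (@is_derive_eq _ _ _ _ _ _ _ _ (is_deriveD (is_deriveD
    (is_derive_monomial 1 (k0 / 2) r)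
    (is_deriveZ (k1 / 6) (is_derive_cubic_norm r)))
    (is_derive_monomial 3 24^-1 r))).
  by rewrite /GRing.scale/= expr1; field.
have := is_derive_shift dr; congr (is_derive _ _ _ _).
by apply/funext => t; rewrite /extremal -/c -/k0 -/k1; field.
Qed.

Lemma is_derive_extremal_slope a b x :
  is_derive x 1 (extremal_slope a b) (peano_kernel a b x).
Proof.
pose c := (a + b) / 2; pose r := x - c.
pose k0 := (b - a) ^+ 2 * (2 - Num.sqrt 2) / 16.
pose k1 := (b - a) * (Num.sqrt 2 / 8 - 2^-1).
have dr : is_derive r 1
  (fun r : R => k0 * r + k1 / 2 * (`|r| * r) + 6^-1 * r ^+ 3)
  (peano_kernel a b x).
  apply: (@is_derive_eq _ _ _ _ _ _ _ _ (is_deriveD (is_deriveD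
    (is_derive_monomial 0 k0 r) (is_deriveZ (k1 / 2) (is_derive_norm_mul r)))
    (is_derive_monomial 2 6^-1 r))).
  rewrite /GRing.scale/= expr0 -(real_normK (num_real r)).
  by rewrite /peano_kernel /tent /peano_profile -/c -/r /k0 /k1; field.
have := is_derive_shift dr; congr (is_derive _ _ _ _).
by apply/funext => t; rewrite /extremal_slope -/c -/k0 -/k1; field.
Qed.

Lemma extremal_derivatives a b : a < b ->
  [/\ differentiable_within a b (extremal a b),
    {in `[a, b], derivative_within a b (extremal a b) =1 extremal_slope a b} &
    {in `[a, b], derivative_within a b (derivative_within a b (extremal a b))
      =1 peano_kernel a b}].
Proof.
move=> ab.
have d1 : {in `[a, b],
    derivative_within a b (extremal a b) =1 extremal_slope a b}.
  move=> x; rewrite in_itv/= => /andP[ax xb].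
  exact: (derivative_withinE ab ax xb (is_derive_extremal a b x)).
split => //.
- move=> x _; apply/cvg_ex; exists (extremal_slope a b x).
  exact: slope_within_cvg (is_derive_extremal a b x).
- move=> x; rewrite in_itv/= => /andP[ax xb].
  by case: (derivative_within_congr ab ax xb d1 (is_derive_extremal_slope a b x)).
Qed.

Lemma extremal_admissible a b : a < b -> admissible a b (extremal a b).
Proof.
move=> ab; have [df d1 d2] := extremal_derivatives ab; split => //; last first.
  exact: continuous_square_integrable (@peano_kernel_continuous _ a b) d2.
have cK : {within `[a, b], continuous (peano_kernel a b)}.
  by apply: continuous_subspaceT; exact: peano_kernel_continuous.
have [M KM] := within_continuous_bounded (ltW ab) cK.
apply: (lipschitz_ac (M := M)) => s t as_ st tb.
rewrite !d1 ?in_itv/= ?as_ ?(le_trans st tb) ?tb ?(le_trans as_ st)//.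
apply: lipschitz_of_derivative KM _ _ as_ st tb.
- apply: continuous_subspaceT.
  exact: is_derive_continuous (is_derive_extremal_slope a b).
- by move=> x _ _; exact: is_derive_extremal_slope.
Qed.

(** The second derivative of [extremal a b] differs from the mean-zero kernel by a
    constant, the case of equality in the Cauchy-Schwarz inequality. *)
Lemma sharpness a b C : a < b -> quad_bound C a b (extremal a b) ->
  sharp_constant <= C.
Proof.
move=> ab; have fadm := extremal_admissible ab.
have [_ _ d2] := extremal_derivatives ab.
rewrite /quad_bound (deviation_identity ab fadm).
set f2 := derivative_within a b _ in d2 *.
have h0 : 0 < b - a by rewrite subr_gt0.
set h := b - a in h0 *.
pose k := mean_zero_kernel a b; pose m := h ^+ 2 / 96 * (4 - 3 * Num.sqrt 2).
have f2k : {in `[a, b], f2 =1 (fun t => k t + m)}.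
  by move=> t /d2 ->; rewrite /k /mean_zero_kernel -/h -/m subrK.
have ck : continuous k by exact: mean_zero_kernel_continuous.
have cint (v : R -> R) : continuous v -> mu.-integrable `[a, b] (EFin \o v).
  by move=> cv; apply: within_continuous_integrable; exact: continuous_subspaceT.
have ik := cint _ ck.
have ik2 : mu.-integrable `[a, b] (EFin \o (fun t => k t ^+ 2)).
  by apply: cint => x; apply: (@continuous_comp _ _ _ k (fun z => z ^+ 2));
    [exact: ck|exact: exprn_continuous].
have ic (r : R) : mu.-integrable `[a, b] (EFin \o (fun=> r)).
  by apply: cint => y; exact: cvg_cst.
have iZ := @integrableZ_segment _ a b; have iD := @integrableD_segment _ a b.
have k0 : \int[mu]_(t in `[a, b]) k t = 0 := Rintegral_mean_zero_kernel ab.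
have kk := Rintegral_mean_zero_kernel_sqr ab; rewrite -/k -/h in kk.
have -> : \int[mu]_(t in `[a, b]) (mean_zero_kernel a b t * f2 t) =
    sharp_constant ^+ 2 * h ^+ 5.
  have -> : \int[mu]_(t in `[a, b]) (mean_zero_kernel a b t * f2 t) =
      \int[mu]_(t in `[a, b]) (k t ^+ 2 + m * k t).
    by apply: eq_Rintegral => t; rewrite inE/= => /f2k ->; rewrite -/k; ring.
  rewrite (RintegralD_segment ik2 (iZ _ m ik)) RintegralZ_segment//.
  by rewrite k0 kk mulr0 addr0.
have I1 : \int[mu]_(t in `[a, b]) f2 t = m * h.
  have -> : \int[mu]_(t in `[a, b]) f2 t = \int[mu]_(t in `[a, b]) (k t + m).
    by apply: eq_Rintegral => t; rewrite inE/= => /f2k ->.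
  rewrite (RintegralD_segment ik (ic m)) k0 add0r.
  exact: Rintegral_cst_segment m (ltW ab).
have I2 : \int[mu]_(t in `[a, b]) (f2 t ^+ 2) =
    sharp_constant ^+ 2 * h ^+ 5 + m ^+ 2 * h.
  (* The constant is made opaque, lest it be read as a product r * v t. *)
  have [q qE] : exists q, q = m ^+ 2 by exists (m ^+ 2).
  have -> : \int[mu]_(t in `[a, b]) (f2 t ^+ 2) =
      \int[mu]_(t in `[a, b]) (k t ^+ 2 + (2 * m * k t + q)).
    by apply: eq_Rintegral => t; rewrite inE/= => /f2k ->; rewrite qE; ring.
  rewrite (RintegralD_segment ik2 (iD _ _ (iZ _ (2 * m) ik) (ic q))).
  rewrite (RintegralD_segment (iZ _ (2 * m) ik) (ic q)) RintegralZ_segment// k0 kk.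
  by rewrite (Rintegral_cst_segment q (ltW ab)) qE mulr0 add0r.
have C0 : 0 < sharp_constant :> R by rewrite sqrtr_gt0 sharp_radicand_gt0.
have p0 : 0 < h `^ (5 / 2) by exact: powR_gt0.
have h5 := powR_five_half_sqr h0.
have -> : sigma f2 a b = sharp_constant * h `^ (5 / 2).
  rewrite /sigma /chebyshevT I1 I2 -/h.
  have -> : h * (h^-1 * (sharp_constant ^+ 2 * h ^+ 5 + m ^+ 2 * h) -
      (h^-1 * (m * h)) ^+ 2) = (sharp_constant * h `^ (5 / 2)) ^+ 2.
    by rewrite [RHS]exprMn h5; field; rewrite gt_eqF.
  by rewrite sqrtr_sqr gtr0_norm// mulr_gt0.
rewrite gtr0_norm; last by rewrite mulr_gt0// exprn_gt0.
rewrite -h5.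
have -> : sharp_constant ^+ 2 * h `^ (5 / 2) ^+ 2 =
  sharp_constant * (sharp_constant * h `^ (5 / 2) ^+ 2) :> R by ring.
have -> : C * (sharp_constant * h `^ (5 / 2)) * h `^ (5 / 2) =
  C * (sharp_constant * h `^ (5 / 2) ^+ 2) by ring.
by rewrite ler_pM2r// mulr_gt0// exprn_gt0.
Qed.

End extremal.

(** * The sharp inequality *)

Theorem theorem17 (R : realType) (a b : R) (hab : a < b) :
  (forall f : R -> R, admissible a b f -> quad_bound sharp_constant a b f) /\
  (forall C : R, (forall f : R -> R, admissible a b f -> quad_bound C a b f) ->
     sharp_constant <= C).
Proof.
split=> [f fadm|C CP]; first exact: sharp_bound.
exact: (sharpness hab (CP _ (extremal_admissible hab))).
Qed.
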